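(* Let $(S,\mathfrak n)$ be a commutative noetherian local ring and let $\omega\in\mathfrak n$ be a non-zerodivisor. Then the exact category $\mathsf{Mon}(\omega,\mathcal G)$ is a Frobenius category. In particular, its projective-injective objects are exactly the direct summands of finite direct sums of objects of the form $(P\xrightarrow{\mathrm{id}}P)\oplus(Q\xrightarrow{\omega}Q)$ for some finitely generated projective $S$-modules $P,Q$.
   Context: All modules are finitely generated. A finitely generated $S$-module $M$ is Gorenstein projective if $\mathrm{Ext}^i_S(M,S)=0=\mathrm{Ext}^i_S(\mathrm{Hom}_S(M,S),S)$ for all $i\ge 1$ and the biduality map $M\to \mathrm{Hom}_S(\mathrm{Hom}_S(M,S),S)$ is an isomorphism; $\mathcal G(S)$ is the category of finitely generated Gorenstein projective $S$-modules. $\mathsf{Mon}(\omega,\mathcal G)$ is the category whose objects are the injective $S$-homomorphisms $(G_1\xrightarrow{f}G_0)$ with $G_1,G_0\in\mathcal G(S)$ and $\omega\,\mathrm{Coker} f=0$; a morphism $(G_1\xrightarrow{f}G_0)\to(G'_1\xrightarrow{f'}G'_0)$ is a pair $(\varphi_1,\varphi_0)$ of $S$-homomorphisms $\varphi_i:G_i\to G_i'$ with $f'\varphi_1=\varphi_0 f$. It is regarded as an exact category (in the sense of Quillen) whose conflations are the componentwise short exact sequences of $S$-homomorphisms all of whose three terms lie in $\mathsf{Mon}(\omega,\mathcal G)$. A map labelled $\omega$ is multiplication by $\omega$. A Frobenius category is an exact category with enough projective objects and enough injective objects (relative to the conflations) in which the projective objects coincide with the injective objects. *)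

(* Defs.v *)
(* Written in MathComp, using the classical axioms of boolp to reflect
   propositions and to give Hom-sets their choiceType structure. *)
From HB Require Import structures.
From mathcomp Require Import all_boot all_order all_algebra boolp.

Set Implicit Arguments.
Unset Strict Implicit.
Unset Printing Implicit Defensive.

Import GRing.Theory.
Local Open Scope ring_scope.

(** ** Commutative rings and their modules *)

Section Rings.
Variable S : comNzRingType.

(* Ideals are the submodules of the regular module; boolean predicates lose
   nothing, as every proposition is reflected by [asbool]. *)
Definition noetherian : Prop :=
  forall I : {pred S^o}, submod_closed I ->
  exists (k : nat) (v : 'I_k -> S), forall x : S,
    x \in I <-> exists c : 'I_k -> S, x = \sum_(i < k) c i * v i.

(* [idealr_closed] includes properness: 1 \notin I. *)
Definition maximal_ideal (m : {pred S}) : Prop :=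
  idealr_closed m /\
  forall I : {pred S}, idealr_closed I -> {subset m <= I} -> m =i I.

Definition local_ring (n : {pred S}) : Prop :=
  maximal_ideal n /\ forall m : {pred S}, maximal_ideal m -> m =i n.

Definition finitely_generated (M : lmodType S) : Prop :=
  exists (k : nat) (v : 'I_k -> M), forall x : M,
    exists c : 'I_k -> S, x = \sum_(i < k) c i *: v i.

Definition surjective (A B : Type) (f : A -> B) : Prop :=
  forall y, exists x, f x = y.

Definition projective_module (P : lmodType S) : Prop :=
  forall (M N : lmodType S) (g : {linear M -> N}) (f : {linear P -> N}),
    surjective g -> exists h : {linear P -> M}, forall x, g (h x) = f x.

Definition fg_projective (P : lmodType S) : Prop :=
  finitely_generated P /\ projective_module P.

Definition exact_at (A B C : lmodType S)
    (f : {linear A -> B}) (g : {linear B -> C}) : Prop :=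
  forall y, g y = 0 <-> exists x, f x = y.

Definition short_exact (A B C : lmodType S)
    (f : {linear A -> B}) (g : {linear B -> C}) : Prop :=
  [/\ injective f, exact_at f g & surjective g].

End Rings.

(** ** The S-module Hom_S(M,N) *)

Section HomModule.
Variables (S : comNzRingType) (M N : lmodType S).

Lemma linear_ext (f g : {linear M -> N}) : f =1 g -> f = g.
Proof.
case: f g => f [[fa] [fs]] [g [[ga] [gs]]] /= /funext fg.
by case: _ / fg ga gs => ga gs; rewrite (Prop_irrelevance fa ga) (Prop_irrelevance fs gs).
Qed.

HB.instance Definition _ := gen_eqMixin {linear M -> N}.
HB.instance Definition _ := gen_choiceMixin {linear M -> N}.

Definition hom_zero : {linear M -> N} := \0.
Definition hom_opp (f : {linear M -> N}) : {linear M -> N} := \- f.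
Definition hom_add (f g : {linear M -> N}) : {linear M -> N} := f \+ g.
Definition hom_scale (a : S) (f : {linear M -> N}) : {linear M -> N} := a \*: f.

Fact hom_addA : associative hom_add.
Proof. by move=> f g h; apply: linear_ext => x /=; rewrite addrA. Qed.
Fact hom_addC : commutative hom_add.
Proof. by move=> f g; apply: linear_ext => x /=; rewrite addrC. Qed.
Fact hom_add0 : left_id hom_zero hom_add.
Proof. by move=> f; apply: linear_ext => x /=; rewrite add0r. Qed.
Fact hom_addN : left_inverse hom_zero hom_opp hom_add.
Proof. by move=> f; apply: linear_ext => x /=; rewrite addNr. Qed.

HB.instance Definition _ :=
  GRing.isZmodule.Build {linear M -> N} hom_addA hom_addC hom_add0 hom_addN.

Fact hom_scaleA a b f : hom_scale a (hom_scale b f) = hom_scale (a * b) f.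
Proof. by apply: linear_ext => x /=; rewrite scalerA. Qed.
Fact hom_scale1 : left_id 1 hom_scale.
Proof. by move=> f; apply: linear_ext => x /=; rewrite scale1r. Qed.
Fact hom_scaleDr : right_distributive hom_scale +%R.
Proof. by move=> a f g; apply: linear_ext => x /=; rewrite scalerDr. Qed.
Fact hom_scaleDl f : {morph hom_scale^~ f : a b / a + b}.
Proof. by move=> a b; apply: linear_ext => x /=; rewrite scalerDl. Qed.

HB.instance Definition _ := GRing.Zmodule_isLmodule.Build S {linear M -> N}
  hom_scaleA hom_scale1 hom_scaleDr hom_scaleDl.

End HomModule.

Section Biduality.
Variables (S : comNzRingType) (M : lmodType S).

Definition dual_module : lmodType S := {linear M -> S^o}.

Definition evaluation (x : M) (phi : dual_module) : S^o := phi x.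

Fact evaluation_is_linear x : linear (evaluation x).
Proof. by []. Qed.
HB.instance Definition _ (x : M) :=
  GRing.isLinear.Build S dual_module S^o *:%R (evaluation x) (evaluation_is_linear x).

End Biduality.

Definition biduality (S : comNzRingType) (M : lmodType S) (x : M) :
  dual_module (dual_module M) := evaluation x.

Fact biduality_is_linear (S : comNzRingType) (M : lmodType S) :
  linear (@biduality S M).
Proof.
move=> a x y; apply: linear_ext => phi.
by rewrite /= /evaluation linearP.
Qed.
HB.instance Definition _ (S : comNzRingType) (M : lmodType S) :=
  GRing.isLinear.Build S M (dual_module (dual_module M)) *:%R (@biduality S M)
    (@biduality_is_linear S M).

(** ** Ext and Gorenstein projective modules *)

Section Ext.
Variable S : comNzRingType.

Record projective_resolution (M : lmodType S) := ProjectiveResolution {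
  res_term : nat -> lmodType S;
  res_diff : forall i, {linear res_term i.+1 -> res_term i};
  res_aug : {linear res_term 0 -> M};
  res_projective : forall i, projective_module (res_term i);
  res_aug_surj : surjective res_aug;
  res_exact0 : exact_at (res_diff 0) res_aug;
  res_exact : forall i, exact_at (res_diff i.+1) (res_diff i) }.

Section Cochains.
Variables (M N : lmodType S) (P : projective_resolution M).

Definition cocycle i (phi : {linear res_term P i -> N}) : Prop :=
  forall x, phi (res_diff P i x) = 0.

Definition coboundary i : {linear res_term P i -> N} -> Prop :=
  match i with
  | 0%N => fun phi => forall x, phi x = 0
  | j.+1 => fun phi => exists psi : {linear res_term P j -> N},
      forall x, phi x = psi (res_diff P j x)
  end.

End Cochains.

(* Ext^i(M,N) = H^i(Hom(P,N)) vanishes. The cohomology does not depend, up to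
   isomorphism, on the resolution P, and every module has one; hence "for all
   P" and "for some P" express the same condition. *)
Definition Ext_vanishes (i : nat) (M N : lmodType S) : Prop :=
  forall (P : projective_resolution M) (phi : {linear res_term P i -> N}),
    cocycle phi -> coboundary phi.

Definition gorenstein_projective (M : lmodType S) : Prop :=
  [/\ finitely_generated M,
      forall i, (1 <= i)%N -> Ext_vanishes i M S^o,
      forall i, (1 <= i)%N -> Ext_vanishes i (dual_module M) S^o
    & bijective (@biduality S M)].

End Ext.

(** ** Cokernels *)

Section Cokernel.
Variables (S : comNzRingType) (M N : lmodType S) (f : {linear M -> N}).

Definition image_pred : {pred N} := fun y => `[< exists x, f x = y >].

Fact image_zmod_closed : zmod_closed image_pred.
Proof.
split=> [|_ _ /asboolP[x <-] /asboolP[y <-]]; apply/asboolP.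
  by exists 0; rewrite linear0.
by exists (x - y); rewrite linearB.
Qed.
HB.instance Definition _ := GRing.isZmodClosed.Build N image_pred image_zmod_closed.

Definition coker : Type := Quotient.quot image_pred.
HB.instance Definition _ := Choice.on coker.
HB.instance Definition _ := GRing.Zmodule.on coker.

Definition coker_pi (y : N) : coker := \pi_(Quotient.quot image_pred)%qT y.

Lemma coker_piP y z : coker_pi y = coker_pi z <-> exists x, f x = y - z.
Proof.
rewrite /coker_pi; split=> [/eqP|yz]; last apply/eqP.
  by rewrite -Quotient.idealrBE => /asboolP.
by rewrite -Quotient.idealrBE; apply/asboolP.
Qed.

Lemma coker_piD : {morph coker_pi : y z / y + z}.
Proof. exact: raddfD. Qed.

Lemma coker_repr (c : coker) : coker_pi (repr c) = c.
Proof. exact: reprK. Qed.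

Definition coker_scale (a : S) (c : coker) : coker := coker_pi (a *: repr c).

Lemma coker_scaleE a y : coker_scale a (coker_pi y) = coker_pi (a *: y).
Proof.
apply/coker_piP; have /coker_piP[x fx] := coker_repr (coker_pi y).
by exists (a *: x); rewrite linearZ /= fx scalerBr.
Qed.

Fact coker_scaleA a b c : coker_scale a (coker_scale b c) = coker_scale (a * b) c.
Proof. by rewrite -(coker_repr c) !coker_scaleE scalerA. Qed.
Fact coker_scale1 : left_id 1 coker_scale.
Proof. by move=> c; rewrite -(coker_repr c) coker_scaleE scale1r. Qed.
Fact coker_scaleDr : right_distributive coker_scale +%R.
Proof.
move=> a c d; rewrite -(coker_repr c) -(coker_repr d) -coker_piD !coker_scaleE.
by rewrite scalerDr coker_piD.
Qed.
Fact coker_scaleDl c : {morph coker_scale^~ c : a b / a + b}.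
Proof.
by move=> a b; rewrite -(coker_repr c) !coker_scaleE scalerDl coker_piD.
Qed.

HB.instance Definition _ := GRing.Zmodule_isLmodule.Build S coker
  coker_scaleA coker_scale1 coker_scaleDr coker_scaleDl.

Lemma coker_annP (w : S) :
  (forall c : coker, w *: c = 0) <-> forall y, exists x, f x = w *: y.
Proof.
have pi0 : coker_pi 0 = 0 by exact: raddf0.
have piP y : w *: coker_pi y = 0 <-> exists x, f x = w *: y.
  by rewrite -pi0 -[w *: y]subr0 -coker_piP -coker_scaleE.
split=> w0 => [y|c]; first exact/piP.
by rewrite -(coker_repr c); apply/piP.
Qed.

End Cokernel.

(** ** Exact categories *)

Record preadditive := Preadditive {
  ob :> Type;
  mor : ob -> ob -> zmodType;
  idm : forall X, mor X X;
  mcomp : forall X Y Z, mor Y Z -> mor X Y -> mor X Z;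
  comp_assoc : forall X Y Z W (h : mor Z W) (g : mor Y Z) (f : mor X Y),
    mcomp h (mcomp g f) = mcomp (mcomp h g) f;
  comp_idl : forall X Y (f : mor X Y), mcomp (idm Y) f = f;
  comp_idr : forall X Y (f : mor X Y), mcomp f (idm X) = f;
  comp_addl : forall X Y Z (g g' : mor Y Z) (f : mor X Y),
    mcomp (g + g') f = mcomp g f + mcomp g' f;
  comp_addr : forall X Y Z (g : mor Y Z) (f f' : mor X Y),
    mcomp g (f + f') = mcomp g f + mcomp g f' }.

Section ExactCategories.
Variable C : preadditive.

Local Notation "g \oc f" := (mcomp g f) (at level 40, left associativity).

Definition is_zero_object (X : C) : Prop :=
  forall Y, (forall f : mor X Y, f = 0) /\ (forall f : mor Y X, f = 0).

(* Z is a direct sum of X and Y. *)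
Definition is_biproduct (X Y Z : C) : Prop :=
  exists (i : mor X Z) (j : mor Y Z) (p : mor Z X) (q : mor Z Y),
    [/\ p \oc i = idm X, q \oc j = idm Y, p \oc j = 0, q \oc i = 0
      & i \oc p + j \oc q = idm Z].

Definition direct_summand (X Y : C) : Prop := exists Z, is_biproduct X Z Y.

Inductive finite_direct_sum (F : C -> Prop) : C -> Prop :=
| fds_zero Z : is_zero_object Z -> finite_direct_sum F Z
| fds_add X Y Z : F X -> finite_direct_sum F Y -> is_biproduct X Y Z ->
    finite_direct_sum F Z.

Definition additive_category : Prop :=
  (exists Z, is_zero_object Z) /\ forall X Y : C, exists Z, is_biproduct X Y Z.

Definition is_iso (X Y : C) (f : mor X Y) : Prop :=
  exists g : mor Y X, g \oc f = idm X /\ f \oc g = idm Y.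

Definition is_kernel (X Y Z : C) (i : mor X Y) (p : mor Y Z) : Prop :=
  p \oc i = 0 /\
  forall (W : C) (f : mor W Y), p \oc f = 0 -> exists! g : mor W X, i \oc g = f.

Definition is_cokernel (X Y Z : C) (i : mor X Y) (p : mor Y Z) : Prop :=
  p \oc i = 0 /\
  forall (W : C) (f : mor Y W), f \oc i = 0 -> exists! g : mor Z W, g \oc p = f.

(* The square  X -i-> Y
               |f     |f'
               Z -j-> W   *)
Definition is_pushout (X Y Z W : C) (i : mor X Y) (f : mor X Z)
    (j : mor Z W) (f' : mor Y W) : Prop :=
  j \oc f = f' \oc i /\
  forall (V : C) (a : mor Y V) (b : mor Z V), a \oc i = b \oc f ->
    exists! c : mor W V, c \oc f' = a /\ c \oc j = b.

(* The square  W -q-> Z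
               |f'    |f
               X -p-> Y   *)
Definition is_pullback (X Y Z W : C) (p : mor X Y) (f : mor Z Y)
    (q : mor W Z) (f' : mor W X) : Prop :=
  f \oc q = p \oc f' /\
  forall (V : C) (a : mor V X) (b : mor V Z), p \oc a = f \oc b ->
    exists! c : mor V W, f' \oc c = a /\ q \oc c = b.

Variable E : forall X Y Z : C, mor X Y -> mor Y Z -> Prop.

Definition inflation (X Y : C) (i : mor X Y) : Prop :=
  exists Z (p : mor Y Z), E i p.
Definition deflation (Y Z : C) (p : mor Y Z) : Prop :=
  exists X (i : mor X Y), E i p.

Record exact_category : Prop := ExactCategory {
  exact_additive : additive_category;
  conflation_kernel : forall (X Y Z : C) (i : mor X Y) (p : mor Y Z),
    E i p -> is_kernel i p /\ is_cokernel i p;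
  conflation_iso : forall (X Y Z X' Y' Z' : C) (i : mor X Y) (p : mor Y Z)
      (i' : mor X' Y') (p' : mor Y' Z')
      (a : mor X X') (b : mor Y Y') (c : mor Z Z'),
    is_iso a -> is_iso b -> is_iso c ->
    b \oc i = i' \oc a -> c \oc p = p' \oc b -> E i p -> E i' p';
  inflation_idm : forall X : C, inflation (idm X);
  deflation_idm : forall X : C, deflation (idm X);
  inflation_comp : forall (X Y Z : C) (i : mor X Y) (j : mor Y Z),
    inflation i -> inflation j -> inflation (j \oc i);
  deflation_comp : forall (X Y Z : C) (p : mor X Y) (q : mor Y Z),
    deflation p -> deflation q -> deflation (q \oc p);
  inflation_pushout : forall (X Y Z : C) (i : mor X Y) (f : mor X Z),
    inflation i -> exists W (j : mor Z W) (f' : mor Y W),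
      is_pushout i f j f' /\ inflation j;
  deflation_pullback : forall (X Y Z : C) (p : mor X Y) (f : mor Z Y),
    deflation p -> exists W (q : mor W Z) (f' : mor W X),
      is_pullback p f q f' /\ deflation q }.

Definition projective_object (P : C) : Prop :=
  forall (Y Z : C) (p : mor Y Z) (f : mor P Z),
    deflation p -> exists g : mor P Y, p \oc g = f.

Definition injective_object (I : C) : Prop :=
  forall (X Y : C) (i : mor X Y) (f : mor X I),
    inflation i -> exists g : mor Y I, g \oc i = f.

Definition enough_projectives : Prop :=
  forall X : C, exists (P : C) (p : mor P X), projective_object P /\ deflation p.

Definition enough_injectives : Prop :=
  forall X : C, exists (I : C) (i : mor X I), injective_object I /\ inflation i.

Definition frobenius_category : Prop :=
  [/\ exact_category, enough_projectives, enough_injectives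
    & forall X : C, projective_object X <-> injective_object X].

End ExactCategories.

(** ** The category Mon(omega, G) *)

Section Arrows.
Variable S : comNzRingType.

Record arrow := Arrow {
  src : lmodType S;
  tgt : lmodType S;
  arr : {linear src -> tgt} }.

Record arrow_mor (A B : arrow) := ArrowMor {
  mor1 : {linear src A -> src B};
  mor0 : {linear tgt A -> tgt B};
  mor_comm : forall x, arr B (mor1 x) = mor0 (arr A x) }.

Section ArrowMorGroup.
Variables A B : arrow.
Implicit Types f g h : arrow_mor A B.

Lemma arrow_mor_ext f g : mor1 f = mor1 g -> mor0 f = mor0 g -> f = g.
Proof.
case: f g => f1 f0 fc [g1 g0 gc] /= e1 e0; move: fc gc; rewrite e1 e0 => fc gc.
by rewrite (Prop_irrelevance fc gc).
Qed.

HB.instance Definition _ := gen_eqMixin (arrow_mor A B).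
HB.instance Definition _ := gen_choiceMixin (arrow_mor A B).

Fact arrow_zero_comm x :
  arr B ((0 : {linear src A -> src B}) x) =
  (0 : {linear tgt A -> tgt B}) (arr A x).
Proof. exact: linear0. Qed.
Definition arrow_zero := ArrowMor arrow_zero_comm.

Fact arrow_opp_comm f x : arr B ((- mor1 f) x) = (- mor0 f) (arr A x).
Proof. by rewrite /= linearN mor_comm. Qed.
Definition arrow_opp f := ArrowMor (arrow_opp_comm f).

Fact arrow_add_comm f g x :
  arr B ((mor1 f + mor1 g) x) = (mor0 f + mor0 g) (arr A x).
Proof. by rewrite /= linearD !mor_comm. Qed.
Definition arrow_add f g := ArrowMor (arrow_add_comm f g).

Fact arrow_addA : associative arrow_add.
Proof. by move=> f g h; apply: arrow_mor_ext; apply: addrA. Qed.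
Fact arrow_addC : commutative arrow_add.
Proof. by move=> f g; apply: arrow_mor_ext; apply: addrC. Qed.
Fact arrow_add0 : left_id arrow_zero arrow_add.
Proof. by move=> f; apply: arrow_mor_ext; apply: add0r. Qed.
Fact arrow_addN : left_inverse arrow_zero arrow_opp arrow_add.
Proof. by move=> f; apply: arrow_mor_ext; apply: addNr. Qed.

HB.instance Definition _ := GRing.isZmodule.Build (arrow_mor A B)
  arrow_addA arrow_addC arrow_add0 arrow_addN.

End ArrowMorGroup.

Definition arrow_idm A : arrow_mor A A :=
  @ArrowMor A A idfun idfun (fun=> erefl).

Fact arrow_comp_comm A B D (g : arrow_mor B D) (f : arrow_mor A B) x :
  arr D ((mor1 g \o mor1 f) x) = (mor0 g \o mor0 f) (arr A x).
Proof. by rewrite /= !mor_comm. Qed.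
Definition arrow_comp A B D (g : arrow_mor B D) (f : arrow_mor A B) :=
  @ArrowMor A D (mor1 g \o mor1 f) (mor0 g \o mor0 f) (arrow_comp_comm g f).

Variable omega : S.

Definition in_Mon (A : arrow) : Prop :=
  [/\ gorenstein_projective (src A), gorenstein_projective (tgt A),
      injective (arr A) & forall c : coker (arr A), omega *: c = 0].

Definition Mon_ob := {A : arrow | in_Mon A}.

Fact Mon_comp_assoc (X Y Z W : Mon_ob) (h : arrow_mor (sval Z) (sval W))
    (g : arrow_mor (sval Y) (sval Z)) (f : arrow_mor (sval X) (sval Y)) :
  arrow_comp h (arrow_comp g f) = arrow_comp (arrow_comp h g) f.
Proof. by apply: arrow_mor_ext; apply: linear_ext. Qed.
Fact Mon_comp_idl (X Y : Mon_ob) (f : arrow_mor (sval X) (sval Y)) :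
  arrow_comp (arrow_idm (sval Y)) f = f.
Proof. by apply: arrow_mor_ext; apply: linear_ext. Qed.
Fact Mon_comp_idr (X Y : Mon_ob) (f : arrow_mor (sval X) (sval Y)) :
  arrow_comp f (arrow_idm (sval X)) = f.
Proof. by apply: arrow_mor_ext; apply: linear_ext. Qed.
Fact Mon_comp_addl (X Y Z : Mon_ob) (g g' : arrow_mor (sval Y) (sval Z))
    (f : arrow_mor (sval X) (sval Y)) :
  arrow_comp (g + g') f = arrow_comp g f + arrow_comp g' f.
Proof. by apply: arrow_mor_ext; apply: linear_ext. Qed.
Fact Mon_comp_addr (X Y Z : Mon_ob) (g : arrow_mor (sval Y) (sval Z))
    (f f' : arrow_mor (sval X) (sval Y)) :
  arrow_comp g (f + f') = arrow_comp g f + arrow_comp g f'.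
Proof. by apply: arrow_mor_ext; apply: linear_ext => x /=; rewrite linearD. Qed.

Definition Mon : preadditive :=
  @Preadditive Mon_ob (fun X Y => arrow_mor (sval X) (sval Y))
    (fun X => arrow_idm (sval X)) (fun X Y Z => @arrow_comp _ _ _)
    Mon_comp_assoc Mon_comp_idl Mon_comp_idr Mon_comp_addl Mon_comp_addr.

Definition Mon_conflation (X Y Z : Mon) (i : mor X Y) (p : mor Y Z) : Prop :=
  short_exact (mor1 i) (mor1 p) /\ short_exact (mor0 i) (mor0 p).

Definition id_arrow (P : lmodType S) : arrow := @Arrow P P idfun.
Definition mul_arrow (Q : lmodType S) : arrow := @Arrow Q Q ( *:%R omega).

(* The objects (P = P) (+) (Q -omega-> Q). For P and Q finitely generated
   projective and omega a nonzerodivisor, [in_Mon] holds of both summands; its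
   proofs only serve to name them as objects of Mon. *)
Definition basic_object (Z : Mon) : Prop :=
  exists (P Q : lmodType S)
    (P_Mon : in_Mon (id_arrow P)) (Q_Mon : in_Mon (mul_arrow Q)),
    [/\ fg_projective P, fg_projective Q
      & @is_biproduct Mon (exist _ _ P_Mon) (exist _ _ Q_Mon) Z].

End Arrows.

(* Main.v *)
(* Gorenstein projectivity is tested through Ext^1 against S along short exact
   sequences, which makes the class closed under extensions and kernels of
   epimorphisms and shows that each of its members embeds in a finitely generated
   projective module with Gorenstein projective cokernel.

   Every object f : G_1 -> G_0 of Mon has a unique g : G_0 -> G_1 with
   f g = omega and g f = omega. Hence Hom out of (P = P), resp. (Q -omega-> Q), is
   Hom(P, G_1), resp. Hom(Q, G_0), and Hom into them is Hom(G_0, P), resp.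
   Hom(G_1, Q); these functors are exact on conflations. Surjections P -> G_1 and
   Q -> G_0 induce a deflation (P = P) (+) (Q -omega-> Q) -> f, while embeddings
   G_0 -> P and G_1 -> Q with Gorenstein projective cokernels induce an inflation
   of f into the same kind of object. *)
Require Import Defs.
From HB Require Import structures.
From mathcomp Require Import all_boot all_order all_algebra boolp.
From mathcomp.multinomials Require Import freeg.

Set Implicit Arguments.
Unset Strict Implicit.
Unset Printing Implicit Defensive.

Import GRing.Theory.
Local Open Scope ring_scope.

(** * Linear maps *)

Section LinearMaps.
Variable S : comNzRingType.
Implicit Types A B C K L M N P Q U V W X Y Z : lmodType S.

(** [Ext_vanishes] offers no Ext modules, hence no long exact sequences. A two-part test replaces
    them: if Ext^1 vanishes on a class of modules stable under syzygies, then Ext vanishes there in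
    all positive degrees. Each closure property amounts to a choice of such a class.

    Cokernels of monomorphisms are the obstacle: for A -> B between Gorenstein projectives, the
    cokernel qualifies when every functional on A extends to B. The embedding into a free module is
    built so that this extension is visible. For the same reason a componentwise injection in Mon
    may have its cokernel outside Mon. Cokernels of inflations are therefore recognised as pushouts,
    hence as extensions of modules already known to be Gorenstein projective. *)

Definition lin A B (f : A -> B) (f_lin : linear f) : {linear A -> B} :=
  HB.pack f (GRing.isLinear.Build S A B *:%R f f_lin).

(** Preimages are chosen pointwise, and injectivity of [i] forces the choice to be linear. *)
Lemma factor_inj A B C (i : {linear A -> B}) (f : {linear C -> B}) :
  injective i -> (forall x, exists y, i y = f x) ->
  exists g : {linear C -> A}, forall x, i (g x) = f x.
Proof.
move=> i_inj /choice[g gP].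
have g_lin : linear g by move=> a x y; apply: i_inj; rewrite linearP !gP linearP.
by exists (lin g_lin).
Qed.

Lemma factor_surj A B C (p : {linear A -> B}) (f : {linear A -> C}) :
  surjective p -> (forall x, p x = 0 -> f x = 0) ->
  exists g : {linear B -> C}, forall x, g (p x) = f x.
Proof.
move=> p_surj p_f; have [s sP] := choice p_surj.
have fE x y : p x = p y -> f x = f y.
  by move=> pxy; apply/subr0_eq; rewrite -linearB p_f // linearB pxy subrr.
have g_lin : linear (f \o s).
  by move=> a x y; rewrite /= -linearP; apply: fE; rewrite linearP !sP.
by exists (lin g_lin) => x; apply: fE; rewrite sP.
Qed.

Lemma surjective_comp A B C (f : {linear A -> B}) (g : {linear B -> C}) :
  surjective f -> surjective g -> surjective (g \o f).
Proof.
by move=> f_surj g_surj z; have [y <-] := g_surj z; have [x <-] := f_surj y; exists x.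
Qed.

Section Kernel.
Variables (M N : lmodType S) (f : {linear M -> N}).

Definition ker_pred : {pred M} := fun x => f x == 0.

Fact ker_submod_closed : submod_closed ker_pred.
Proof.
split=> [|a x y]; first by rewrite unfold_in linear0.
by rewrite !unfold_in linearP => /eqP-> /eqP->; rewrite scaler0 addr0.
Qed.
HB.instance Definition _ :=
  GRing.isSubmodClosed.Build S M ker_pred ker_submod_closed.

Definition ker_type := {x : M | ker_pred x}.
HB.instance Definition _ := SubChoice.on ker_type.
HB.instance Definition _ := [SubChoice_isSubLmodule of ker_type by <:].

Lemma ker_exists : exists (K : lmodType S) (i : {linear K -> M}),
  injective i /\ exact_at i f.
Proof.
exists ker_type, \val; split=> [|y]; first exact: val_inj.
split=> [fy|[x <-]]; last exact/eqP/(valP x).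
by have ky : ker_pred y by [apply/eqP]; exists (exist _ y ky).
Qed.
End Kernel.

Lemma coker_exists M N (f : {linear M -> N}) :
  exists (C : lmodType S) (p : {linear N -> C}), surjective p /\ exact_at f p.
Proof.
have p_lin : linear (@coker_pi S M N f).
  by move=> a x y; rewrite coker_piD -coker_scaleE.
have pi0 : coker_pi f 0 = 0 by exact: raddf0.
exists (coker f), (lin p_lin); split=> [c|y]; first by exists (repr c); apply: coker_repr.
by rewrite /= -pi0 coker_piP subr0.
Qed.

Lemma short_exact0 A B C (i : {linear A -> B}) (p : {linear B -> C}) :
  short_exact i p -> forall x, p (i x) = 0.
Proof. by case=> _ ip _ x; apply/ip; exists x. Qed.

Lemma ker_short_exact B C (p : {linear B -> C}) :
  surjective p -> exists A (i : {linear A -> B}), short_exact i p.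
Proof. by move=> p_surj; have [A [i [i_inj ip]]] := ker_exists p; exists A, i. Qed.

Lemma coker_short_exact A B (i : {linear A -> B}) :
  injective i -> exists C (p : {linear B -> C}), short_exact i p.
Proof. by move=> i_inj; have [C [p [p_surj ip]]] := coker_exists i; exists C, p. Qed.

(** * Products, pullbacks and pushouts of modules *)

Lemma pair_lin A B C (f : {linear A -> B}) (g : {linear A -> C}) :
  linear (fun x => (f x, g x)).
Proof. by move=> a x y; rewrite !linearP. Qed.

Lemma copair_lin A B C (f : {linear A -> C}) (g : {linear B -> C}) :
  linear (fun x : A * B => f x.1 + g x.2).
Proof. by move=> a x y; rewrite !linearP /= scalerDr addrACA. Qed.

Definition pairing A B C (f : {linear A -> B}) (g : {linear A -> C}) :
  {linear A -> (B * C)%type} := lin (pair_lin f g).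

Definition copairing A B C (f : {linear A -> C}) (g : {linear B -> C}) :
  {linear (A * B)%type -> C} := lin (copair_lin f g).

(** Elementwise form of the exactness of 0 -> W -> A x B -> C; both short exact sequences and the
    universal property in Mon are read off from it. *)
Definition module_pullback A B C W (f : {linear A -> C}) (g : {linear B -> C})
    (p : {linear W -> A}) (q : {linear W -> B}) : Prop :=
  [/\ forall w, f (p w) = g (q w),
      forall w, p w = 0 -> q w = 0 -> w = 0
    & forall x y, f x = g y -> exists w, p w = x /\ q w = y].

(** Exactness of C -> A x B -> W -> 0, the first map being (f, -g) and the second i + j. *)
Definition module_pushout A B C W (f : {linear C -> A}) (g : {linear C -> B})
    (i : {linear A -> W}) (j : {linear B -> W}) : Prop :=
  [/\ forall x, i (f x) = j (g x),
      forall w, exists x y, w = i x + j y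
    & forall x y, i x = j y -> exists z, f z = x /\ g z = y].

Lemma pullback_exists A B C (f : {linear A -> C}) (g : {linear B -> C}) :
  exists W (p : {linear W -> A}) (q : {linear W -> B}), module_pullback f g p q.
Proof.
have [W [i [i_inj iP]]] := ker_exists (copairing f (- g)).
exists W, (fst \o i), (snd \o i); split=> /=.
- move=> w; have /iP /= : exists w', i w' = i w by exists w.
  by move=> /eqP; rewrite subr_eq0 => /eqP.
- by move=> w i1 i2; apply: i_inj; rewrite linear0 [i w]surjective_pairing i1 i2.
- move=> x y fg; have /iP[w iw] : copairing f (- g) (x, y) = 0.
    by rewrite /= fg subrr.
  by exists w; rewrite iw.
Qed.

Lemma pushout_exists A B C (f : {linear C -> A}) (g : {linear C -> B}) :
  exists W (i : {linear A -> W}) (j : {linear B -> W}), module_pushout f g i j.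
Proof.
have [W [p [p_surj pP]]] := coker_exists (pairing f (- g)).
exists W, (p \o pairing idfun \0), (p \o pairing \0 idfun); split=> /=.
- move=> x; apply/subr0_eq; rewrite -linearB; apply/pP; exists x => /=.
  by congr (_, _); rewrite /= ?subr0 ?sub0r.
- move=> w; have [[x y] <-] := p_surj w; exists x, y; rewrite -linearD.
  by congr (p (_, _)); rewrite /= ?addr0 ?add0r.
- move=> x y pxy; have /pP[z [fz gz]] : p (x, - y) = 0.
    have -> : (x, - y) = (x, 0) - (0, y) by congr (_, _); rewrite /= ?subr0 ?sub0r.
    by rewrite linearB pxy subrr.
  by exists z; split=> //; apply: oppr_inj.
Qed.

Lemma pullbackC A B C W (f : {linear A -> C}) (g : {linear B -> C})
    (p : {linear W -> A}) (q : {linear W -> B}) :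
  module_pullback f g p q -> module_pullback g f q p.
Proof.
case=> fg pq0 W_ex; split=> [w|w qw pw|x y gf]; first exact: esym.
  exact: pq0.
by have [//|w [? ?]] := W_ex y x; exists w.
Qed.

Lemma pushoutC A B C W (f : {linear C -> A}) (g : {linear C -> B})
    (i : {linear A -> W}) (j : {linear B -> W}) :
  module_pushout f g i j -> module_pushout g f j i.
Proof.
case=> fg W_gen W_eq; split=> [w|w|x y ji]; first exact: esym.
  by have [x [y ->]] := W_gen w; exists y, x; rewrite addrC.
by have [//|w [? ?]] := W_eq y x; exists w.
Qed.

Lemma pullback_short_exact A B C K W (f : {linear A -> C}) (g : {linear B -> C})
    (p : {linear W -> A}) (q : {linear W -> B}) (i : {linear K -> A}) :
  module_pullback f g p q -> short_exact i f ->
  exists j : {linear K -> W}, short_exact j q /\ forall x, p (j x) = i x.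
Proof.
case=> fg pq0 W_ex [i_inj if_ex f_surj].
have qp_inj : injective (pairing p q).
  by apply: raddf_inj => w /= [pw qw]; apply: pq0.
have [x|j jP] := factor_inj (f := pairing i \0) qp_inj.
  have [|w [pw qw]] := W_ex (i x) 0; first by rewrite linear0; apply/if_ex; exists x.
  by exists w; rewrite /= pw qw.
have pj x : p (j x) = i x by case: (jP x).
have qj x : q (j x) = 0 by case: (jP x).
exists j; split=> //; split=> [|w|y].
- by move=> x y jxy; apply: i_inj; rewrite -!pj jxy.
- split=> [qw|[x <-]//]; have /if_ex[x ix] : f (p w) = 0 by rewrite fg qw linear0.
  by exists x; apply: qp_inj; rewrite /= pj qj ix qw.
- by have [x fx] := f_surj (g y); have [w [_ <-]] := W_ex _ _ fx; exists w.
Qed.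

Lemma pushout_short_exact A B C K W (f : {linear C -> A}) (g : {linear C -> B})
    (i : {linear A -> W}) (j : {linear B -> W}) (p : {linear A -> K}) :
  module_pushout f g i j -> short_exact f p ->
  exists q : {linear W -> K}, short_exact j q /\ forall x, q (i x) = p x.
Proof.
case=> fg W_gen W_eq [f_inj fp_ex p_surj].
have ij_surj : surjective (copairing i j).
  by move=> w; have [x [y ->]] := W_gen w; exists (x, y).
have [[x y] /= ij0|q qP] := factor_surj (f := p \o fst) ij_surj.
  have [|z [fz _]] := W_eq x (- y); first by rewrite linearN; apply/eqP; rewrite -addr_eq0 ij0.
  by apply/fp_ex; exists z.
have qi x : q (i x) = p x by have := qP (x, 0); rewrite /= linear0 addr0.
have qj x : q (j x) = 0 by have := qP (0, x); rewrite /= !linear0 add0r.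
exists q; split=> //; split=> [|w|y].
- apply: raddf_inj => y jy; have [|z [fz <-]] := W_eq 0 y; first by rewrite linear0 jy.
  by rewrite (f_inj z 0) ?linear0.
- split=> [qw|[x <-]//]; have [x [y wE]] := W_gen w; move: qw.
  rewrite wE linearD qi qj addr0 => /fp_ex[z <-].
  by exists (g z + y); rewrite fg linearD.
- by have [x <-] := p_surj y; exists (i x).
Qed.

(** Up to a sign on Q, the cokernel of (f, g) is the pushout of f and g. With [pushout_short_exact],
    this presents the cokernel of a diagonal embedding as an extension. *)
Lemma coker_pairing_pushout A P Q C
    (f : {linear A -> P}) (g : {linear A -> Q}) (p : {linear (P * Q)%type -> C}) :
  short_exact (pairing f g) p ->
  module_pushout f g (p \o pairing idfun \0) (\- (p \o pairing \0 idfun)).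
Proof.
move=> fgp; have [fg_inj fgp_ex p_surj] := fgp; split.
- move=> x /=; apply/eqP; rewrite -addr_eq0 -linearD; apply/eqP/fgp_ex; exists x.
  by congr (_, _); rewrite /= ?addr0 ?add0r.
- move=> w; have [[x y] <-] := p_surj w; exists x, (- y).
  by rewrite /= -linearB; congr (p (_, _)); rewrite /= ?subr0 ?sub0r ?opprK.
- move=> x y /= /eqP; rewrite -addr_eq0 -linearD => /eqP/fgp_ex[a [fa ga]]; exists a.
  by rewrite fa ga addr0 add0r.
Qed.

End LinearMaps.

(** * Vanishing of Ext *)

Section Resolutions.
Variable S : comNzRingType.
Implicit Types A B C K L M N P Q U V W X Y Z : lmodType S.

(** * Free covers and projective resolutions *)

Lemma fglift_linear (K : choiceType) M (f : K -> M) :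
  linear (fglift f : {freeg K / S} -> M).
Proof.
have scaleU c k (x : K) : c *: << k *g x >> = << c * k *g x >> :> {freeg K / S}.
  by apply/eqP/freeg_eqP => y; rewrite coeffZ !coeffU mulrA.
pose fB := GRing.isZmodMorphism.Build _ _ _ (lift_is_additive f).
pose g : {additive {freeg K / S} -> M} := HB.pack (fglift f : {freeg K / S} -> M) fB.
suff gZ c D : g (c *: D) = c *: g D.
  by move=> c D1 D2; rewrite -[fglift f]/(g : _ -> _) raddfD gZ.
rewrite -(freeg_sumE D) scaler_sumr !raddf_sum.
by apply: eq_bigr => x _; rewrite scaleU /= !liftU scalerA.
Qed.

(** Free on all elements of M: no generators are chosen, and the construction applies again to the
    kernels, which need not be finitely generated. *)
Definition free_cover M : lmodType S := {freeg M / S}.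

Definition free_cover_map M : {linear free_cover M -> M} :=
  lin (fglift_linear (id : M -> M)).

Lemma free_cover_surj M : surjective (free_cover_map M).
Proof. by move=> x; exists << 1 *g x >>; rewrite /= liftU scale1r. Qed.

Lemma free_cover_projective M : projective_module (free_cover M).
Proof.
move=> X Y g f /choice[s sP].
exists (lin (fglift_linear (fun x : M => s (f << 1 *g x >>)))) => D /=.
rewrite -[fglift _]/(lin (fglift_linear (fun x : M => s (f << 1 *g x >>))) : _ -> _).
rewrite -(freeg_sumE D) !raddf_sum; apply: eq_bigr => x _ /=.
rewrite liftU linearZ sP -linearZ; congr (f _).
by apply/eqP/freeg_eqP => y; rewrite coeffZ !coeffU mul1r.
Qed.

Fixpoint free_syzygy M n : lmodType S :=
  if n is n'.+1 then ker_type (free_cover_map (free_syzygy M n')) else M.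

Definition free_res_diff M n :
    {linear free_cover (free_syzygy M n.+1) -> free_cover (free_syzygy M n)} :=
  \val \o free_cover_map (free_syzygy M n.+1).

Lemma free_res_diff_exact M n A (f : {linear free_cover (free_syzygy M n) -> A}) :
  (forall x, f x = 0 <-> free_cover_map _ x = 0) -> exact_at (free_res_diff M n) f.
Proof.
move=> fE x; split=> [/fE x0|[y <-]]; last by apply/fE/eqP/(valP (free_cover_map _ y)).
have kx : ker_pred (free_cover_map (free_syzygy M n)) x by apply/eqP.
have [y yx] := free_cover_surj (exist _ x kx : free_syzygy M n.+1).
by exists y; apply: (congr1 val yx).
Qed.

Definition free_resolution M : projective_resolution M.
Proof.
apply: (@ProjectiveResolution S M (fun n => free_cover (free_syzygy M n))
  (free_res_diff M) (free_cover_map M)).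
- by move=> i; apply: free_cover_projective.
- exact: free_cover_surj.
- exact: free_res_diff_exact.
- move=> i; apply: free_res_diff_exact => x.
  by split=> x0; [apply: val_inj | apply: (congr1 val x0)].
Defined.

Lemma projective_cover_exists M :
  exists P (p : {linear P -> M}), projective_module P /\ surjective p.
Proof.
exists (free_cover M), (free_cover_map M).
by split; [apply: free_cover_projective | apply: free_cover_surj].
Qed.

Definition splice_term K P (R : projective_resolution K) n : lmodType S :=
  if n is n'.+1 then res_term R n' else P.

Definition splice_diff K P (i : {linear K -> P}) (R : projective_resolution K) n :
    {linear splice_term P R n.+1 -> splice_term P R n} :=
  match n with 0 => i \o res_aug R | n'.+1 => res_diff R n' end.

(** The terms of R are shifted by one degree. The shift holds by conversion, so a cocycle on R of
    positive degree is literally a cocycle on the spliced resolution one degree higher: this is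
    dimension shifting. *)
Definition splice K P M (i : {linear K -> P}) (p : {linear P -> M})
    (P_proj : projective_module P) (ip : short_exact i p)
    (R : projective_resolution K) : projective_resolution M.
Proof.
apply: (@ProjectiveResolution S M (splice_term P R) (splice_diff i R) p).
- by case=> [|n] //=; apply: res_projective.
- by case: ip.
- case: ip => _ ip _ x; split=> [/ip[y <-]|[y <-]]; last by apply/ip; eexists.
  by have [z <-] := res_aug_surj R y; exists z.
- case=> [|n] /=; last exact: res_exact.
  move=> x; rewrite -res_exact0; case: ip => i_inj _ _ /=.
  by split=> [|->]; [rewrite -(linear0 i) => /i_inj | rewrite linear0].
Defined.

End Resolutions.

(** * Modules with vanishing Ext into a fixed module N *)

Section Ext.
Variables (S : comNzRingType) (N : lmodType S).
Implicit Types A B C K L M P Q U V W X Y Z : lmodType S.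

(* Ext^1(M,N) = 0, phrased without a resolution: along every extension of M,
   every map to N extends. *)
Definition Ext1_zero M : Prop :=
  forall A B (i : {linear A -> B}) (p : {linear B -> M}), short_exact i p ->
  forall f : {linear A -> N}, exists g : {linear B -> N}, forall x, g (i x) = f x.

Definition Ext_orthogonal M : Prop := forall i, (1 <= i)%N -> Ext_vanishes i M N.

Lemma projective_Ext1_zero P : projective_module P -> Ext1_zero P.
Proof.
move=> P_proj A B i p ip f; have [i_inj ip_ex p_surj] := ip.
have [s sP] := P_proj _ _ p idfun p_surj.
have [x|r rP] := factor_inj (f := idfun \- (s \o p)) i_inj.
  by apply/ip_ex; rewrite /= linearB sP subrr.
exists (f \o r) => x /=; congr (f _); apply: i_inj.
by rewrite rP /= (short_exact0 ip) linear0 subr0.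
Qed.

(** L is the preimage of A under P -> B. The module P is a projective cover when syzygies are
    compared, and an extension of B in [Ext1_zero_extension]. *)
Lemma cover_ker_short_exact A B C P K L (i : {linear A -> B}) (p : {linear B -> C})
    (k : {linear K -> P}) (b : {linear P -> B}) (l : {linear L -> P}) :
  short_exact i p -> short_exact k b -> short_exact l (p \o b) ->
  exists (k' : {linear K -> L}) (b' : {linear L -> A}),
    [/\ short_exact k' b', forall x, l (k' x) = k x & forall x, i (b' x) = b (l x)].
Proof.
move=> ip kb lpb; have [i_inj ip_ex _] := ip.
have [k_inj kb_ex b_surj] := kb; have [l_inj lpb_ex _] := lpb.
have [x|k' k'P] := factor_inj (f := k) l_inj.
  by apply/lpb_ex; rewrite /= (short_exact0 kb) linear0.
have [x|b' b'P] := factor_inj (f := b \o l) i_inj.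
  by apply/ip_ex; apply: (short_exact0 lpb).
exists k', b'; split=> //; split=> [x y kxy|x|y].
- by apply: k_inj; rewrite -!k'P kxy.
- split=> [b'x|[y <-]].
    have /kb_ex[y ky] : b (l x) = 0 by rewrite -[LHS]b'P b'x linear0.
    by exists y; apply: l_inj; rewrite k'P.
  by apply: i_inj; rewrite b'P /= k'P (short_exact0 kb) linear0.
- have [x bx] := b_surj (i y).
  have /lpb_ex[x' lx'] : (p \o b) x = 0 by rewrite /= bx (short_exact0 ip).
  by exists x'; apply: i_inj; rewrite b'P /= lx'.
Qed.

(** An extension V of B by U contains the preimage V' of A. The map f is extended from U to V' by
    the property of A, then from V' to V by that of C. *)
Lemma Ext1_zero_extension A B C (i : {linear A -> B}) (p : {linear B -> C}) :
  short_exact i p -> Ext1_zero A -> Ext1_zero C -> Ext1_zero B.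
Proof.
move=> ip A0 C0 U V j q jq f; have [i_inj ip_ex p_surj] := ip.
have [j_inj jq_ex q_surj] := jq.
have pq_surj := surjective_comp q_surj p_surj.
have [V' [k kpq]] := ker_short_exact pq_surj.
have [j' [q' [j'q' j'P q'P]]] := cover_ker_short_exact ip jq kpq.
have [g' g'P] := A0 _ _ _ _ j'q' f.
have [g gP] := C0 _ _ _ _ kpq g'.
by exists g => x; rewrite -j'P gP g'P.
Qed.

(** Let W be the pullback of V and B over C. A map extended from U to W is corrected by a map from B
    so as to kill A, and then descends to V. *)
Lemma Ext1_zero_coker A B C (i : {linear A -> B}) (p : {linear B -> C}) :
  short_exact i p -> Ext1_zero B ->
  (forall f : {linear A -> N}, exists g : {linear B -> N}, forall x, g (i x) = f x) ->
  Ext1_zero C.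
Proof.
move=> ip B0 i_ext U V j q jq f.
have [W [v [b Wpb]]] := pullback_exists q p.
have [jw [jwb vjw]] := pullback_short_exact Wpb jq.
have [iw [iwv biw]] := pullback_short_exact (pullbackC Wpb) ip.
have [g gP] := B0 _ _ _ _ jwb f; have [h hP] := i_ext (g \o iw).
have [_ iwv_ex v_surj] := iwv.
have [w /iwv_ex[x <-]|e eP] := factor_surj (f := g \- (h \o b)) v_surj.
  by rewrite /= biw hP subrr.
by exists e => x; rewrite -vjw eP /= gP (short_exact0 jwb) linear0 subr0.
Qed.

(** The conclusion about [d] at n + 1 has the form of the hypothesis about [e] at n, so the step
    iterates along the resolution. *)
Lemma resolution_syzygy M (R : projective_resolution M) n K
    (e : {linear res_term R n -> K}) :
  surjective e -> exact_at (res_diff R n) e ->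
  exists L (i : {linear L -> res_term R n}) (d : {linear res_term R n.+1 -> L}),
    [/\ short_exact i e, forall x, i (d x) = res_diff R n x, surjective d
      & exact_at (res_diff R n.+1) d].
Proof.
move=> e_surj de; have [L [i ie]] := ker_short_exact e_surj.
have [i_inj ie_ex _] := ie.
have [x|d dP] := factor_inj (f := res_diff R n) i_inj.
  by apply/ie_ex/de; exists x.
exists L, i, d; split=> // [y|x].
  have /de[x dx] := short_exact0 ie y.
  by exists x; apply: i_inj; rewrite dP.
rewrite -(res_exact (p := R)) -dP.
by split=> [->|]; [rewrite linear0 | rewrite -(linear0 i) => /i_inj].
Qed.

(** A cocycle of degree n + 1 is a map out of the syzygy L inside R_n, and it is a coboundary once
    it extends to R_n. The quotient of R_n by L is the n-th syzygy, which still lies in F, so Ext^1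
    decides. *)
Lemma Ext_orthogonal_coind (F : lmodType S -> Prop) :
  (forall M, F M -> Ext1_zero M) ->
  (forall K P M (i : {linear K -> P}) (p : {linear P -> M}),
     short_exact i p -> projective_module P -> F M -> F K) ->
  forall M, F M -> Ext_orthogonal M.
Proof.
move=> F_Ext F_syz M FM [//|n] _ R f f_cocycle.
have [K [e [FK e_surj de]]] : exists K (e : {linear res_term R n -> K}),
    [/\ F K, surjective e & exact_at (res_diff R n) e].
  elim: n {f f_cocycle} => [|n [K [e [FK e_surj de]]]].
    by exists M, (res_aug R); split=> //; [apply: res_aug_surj | apply: res_exact0].
  have [L [i [d [ie _ d_surj dd]]]] := resolution_syzygy e_surj de.
  by exists L, d; split=> //; apply: F_syz ie _ FK; apply: res_projective.
have [L [i [d [ie id d_surj dd]]]] := resolution_syzygy e_surj de.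
have [x /dd[y <-]|f' f'P] := factor_surj (f := f) d_surj; first exact: f_cocycle.
have [g gP] := F_Ext K FK _ _ _ _ ie f'.
by exists g => x; rewrite -id gP f'P.
Qed.

(** Lifting the augmentation to s : R_0 -> B makes B a quotient of R_0 x A and induces t : R_1 -> A.
    The cocycle f t is of the form u d_0, and this makes (u, f) vanish on the kernel of (s, i). *)
Lemma Ext_orthogonal_Ext1 M : Ext_orthogonal M -> Ext1_zero M.
Proof.
move=> /(_ 1%N isT (free_resolution M)); move: (free_resolution M) => R M1.
move=> A B i p ip f; have [i_inj ip_ex p_surj] := ip.
have [s sP] := res_projective (p := R) (res_aug R) p_surj.
have aug0 x : res_aug R (res_diff R 0 x) = 0.
  by apply/(res_exact0 (p := R)); exists x.
have diff0 x : res_diff R 0 (res_diff R 1 x) = 0.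
  by apply/(res_exact (p := R)); exists x.
have [x|t tP] := factor_inj (f := s \o res_diff R 0) i_inj.
  by apply/ip_ex; rewrite /= sP aug0.
have [x|u uP] := M1 (f \o t).
  suff /= -> : t (res_diff R 1 x) = 0 by rewrite linear0.
  by apply: i_inj; rewrite tP /= diff0 !linear0.
have si_surj : surjective (copairing s i).
  move=> b; have [x xP] := res_aug_surj R (p b).
  have /ip_ex[a ia] : p (b - s x) = 0 by rewrite linearB sP xP subrr.
  by exists (x, a); rewrite /= ia addrC subrK.
have [[x a] /= sia0|g gP] := factor_surj (f := copairing u f) si_surj; last first.
  by exists g => a; have := gP (0, a); rewrite /= !linear0 !add0r.
have /(res_exact0 (p := R))[y yx] : res_aug R x = 0.
  by rewrite -sP -[RHS](linear0 p) -sia0 linearD (short_exact0 ip) addr0.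
rewrite -yx -uP /= -linearD -[RHS](linear0 f); congr (f _).
by apply: i_inj; rewrite linearD tP /= yx sia0 linear0.
Qed.

Lemma Ext_orthogonal_syzygy K P M (i : {linear K -> P}) (p : {linear P -> M}) :
  short_exact i p -> projective_module P -> Ext_orthogonal M -> Ext_orthogonal K.
Proof.
move=> ip P_proj M_orth [//|n] _ R f f_cocycle.
exact: M_orth n.+2 isT (splice P_proj ip R) f f_cocycle.
Qed.

(** The stable class consists of M and all orthogonal modules: syzygies of M fall into the second
    kind. *)
Lemma Ext_orthogonal_step M :
  Ext1_zero M ->
  (forall K P (i : {linear K -> P}) (p : {linear P -> M}),
     short_exact i p -> projective_module P -> Ext_orthogonal K) ->
  Ext_orthogonal M.
Proof.
move=> M1 M_syz.
apply: (@Ext_orthogonal_coind (fun L => L = M \/ Ext_orthogonal L)); last by left.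
- by move=> L [->//|]; apply: Ext_orthogonal_Ext1.
- move=> K P L i p ip P_proj [LM|L_orth]; right.
    by move: i p ip; rewrite LM => i p ip; apply: M_syz ip P_proj.
  exact: Ext_orthogonal_syzygy ip P_proj L_orth.
Qed.

Lemma projective_Ext_orthogonal P : projective_module P -> Ext_orthogonal P.
Proof.
apply: Ext_orthogonal_coind => {}P; first exact: projective_Ext1_zero.
move=> Q L i p ip Q_proj L_proj X Y g f g_surj.
have [i_inj ip_ex p_surj] := ip.
have [s sP] := L_proj _ _ p idfun p_surj.
have [x|r rP] := factor_inj (f := idfun \- (s \o p)) i_inj.
  by apply/ip_ex; rewrite /= linearB sP subrr.
have [h hP] := Q_proj _ _ g (f \o r) g_surj.
exists (h \o i) => x; rewrite /= hP /=; congr (f _); apply: i_inj.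
by rewrite rP /= (short_exact0 ip) linear0 subr0.
Qed.

(** With P covering B, the module A is the cokernel of K -> L, where L is a syzygy of C and so
    inherits the vanishing of Ext^1. Maps K -> N extend to P because Ext^1(B,N) = 0, and are then
    restricted to L. *)
Lemma Ext1_zero_ker A B C (i : {linear A -> B}) (p : {linear B -> C}) :
  short_exact i p -> Ext1_zero B -> Ext_orthogonal C -> Ext1_zero A.
Proof.
move=> ip B1 C_orth; have [i_inj ip_ex p_surj] := ip.
have [P [b [P_proj b_surj]]] := projective_cover_exists B.
have pb_surj := surjective_comp b_surj p_surj.
have [K [k kb]] := ker_short_exact b_surj.
have [L [l lpb]] := ker_short_exact pb_surj.
have [k' [b' [k'b' k'P _]]] := cover_ker_short_exact ip kb lpb.
apply: (Ext1_zero_coker k'b').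
- by apply: Ext_orthogonal_Ext1; apply: Ext_orthogonal_syzygy lpb P_proj C_orth.
- move=> f; have [g gP] := B1 _ _ _ _ kb f.
  by exists (g \o l) => x; rewrite /= k'P gP.
Qed.

(* Horseshoe: syzygies of B and C can be chosen so that the given syzygy K of A
   is the kernel of an epimorphism between them. *)
Lemma Ext_orthogonal_ker A B C (i : {linear A -> B}) (p : {linear B -> C}) :
  short_exact i p -> Ext_orthogonal B -> Ext_orthogonal C -> Ext_orthogonal A.
Proof.
move=> ip B_orth C_orth.
pose F A' := exists B' C' (i' : {linear A' -> B'}) (p' : {linear B' -> C'}),
  [/\ short_exact i' p', Ext_orthogonal B' & Ext_orthogonal C'].
apply: (@Ext_orthogonal_coind F); last by exists B, C, i, p.
- move=> {i p ip B_orth C_orth} {}A [{}B [{}C [i [p [ip B_orth C_orth]]]]].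
  exact: Ext1_zero_ker ip (Ext_orthogonal_Ext1 B_orth) C_orth.
move=> {i p ip B_orth C_orth} K P {}A k a ka P_proj.
move=> [{}B [{}C [i [p [ip B_orth C_orth]]]]].
have [i_inj ip_ex p_surj] := ip; have [k_inj ka_ex a_surj] := ka.
have [Q [b [Q_proj b_surj]]] := projective_cover_exists B.
(* B is covered by P x Q and C by Q, so that the second projection carries the syzygy L of B onto
   the syzygy M of C. *)
have iab_surj : surjective (copairing (i \o a) b).
  by move=> y; have [x bx] := b_surj y; exists (0, x); rewrite /= !linear0 add0r.
have pb_surj := surjective_comp b_surj p_surj.
have [L [l le]] := ker_short_exact iab_surj; have [l_inj le_ex _] := le.
have [M [m mpb]] := ker_short_exact pb_surj; have [m_inj mpb_ex _] := mpb.
have lP x : i (a (l x).1) + b (l x).2 = 0 := short_exact0 le x.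
have [x|k' k'P] := factor_inj (f := pairing k \0) l_inj.
  by apply/le_ex; rewrite /= (short_exact0 ka) !linear0 addr0.
have [x|q qP] := factor_inj (f := snd \o l) m_inj.
  apply/mpb_ex; have := congr1 p (lP x).
  by rewrite linearD (short_exact0 ip) add0r linear0.
exists L, M, k', q; split.
- split=> [x y kxy|x|y].
  + by apply: k_inj; have := congr1 (fst \o l) kxy; rewrite /= !k'P.
  + split=> [qx|[y <-]]; last by apply: m_inj; rewrite qP /= k'P linear0.
    have l2 : (l x).2 = 0 by rewrite -[LHS]qP qx linear0.
    have /ka_ex[y ky] : a (l x).1 = 0.
      by apply: i_inj; have := lP x; rewrite l2 !linear0 addr0.
    by exists y; apply: l_inj; rewrite k'P /= [l x]surjective_pairing l2 ky.
  + have /ip_ex[a' ia'] := short_exact0 mpb y.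
    have [x ax] := a_surj a'.
    have /le_ex[w lw] : copairing (i \o a) b (- x, m y) = 0.
      by rewrite /= linearN ax linearN ia' /= addNr.
    by exists w; apply: m_inj; rewrite qP /= lw.
- apply: Ext_orthogonal_syzygy le _ B_orth.
  move=> X Y g f g_surj.
  have [h hP] := P_proj _ _ g (f \o pairing idfun \0) g_surj.
  have [h' h'P] := Q_proj _ _ g (f \o pairing \0 idfun) g_surj.
  exists (copairing h h') => -[x y]; rewrite /= linearD hP h'P /= -linearD.
  by congr (f (_, _)); rewrite /= ?addr0 ?add0r.
- exact: Ext_orthogonal_syzygy mpb Q_proj C_orth.
Qed.

(** For a syzygy K of B inside P, the kernel L of P -> C is a syzygy of C, and K is the kernel of an
    epimorphism L -> A. *)
Lemma Ext_orthogonal_extension A B C (i : {linear A -> B}) (p : {linear B -> C}) :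
  short_exact i p -> Ext_orthogonal A -> Ext_orthogonal C -> Ext_orthogonal B.
Proof.
move=> ip A_orth C_orth; have [i_inj ip_ex p_surj] := ip.
apply: Ext_orthogonal_step.
  by apply: (Ext1_zero_extension ip); apply: Ext_orthogonal_Ext1.
move=> K P k b kb P_proj; have [k_inj kb_ex b_surj] := kb.
have pb_surj := surjective_comp b_surj p_surj.
have [L [l lpb]] := ker_short_exact pb_surj.
have [k' [b' [k'b' _ _]]] := cover_ker_short_exact ip kb lpb.
exact: Ext_orthogonal_ker k'b' (Ext_orthogonal_syzygy lpb P_proj C_orth) A_orth.
Qed.

(** For a syzygy K of C inside P, the pullback W of P and B over C is an extension of P by A, and K
    is the kernel of W -> B. *)
Lemma Ext_orthogonal_coker A B C (i : {linear A -> B}) (p : {linear B -> C}) :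
  short_exact i p -> Ext_orthogonal A -> Ext_orthogonal B ->
  (forall f : {linear A -> N}, exists g : {linear B -> N}, forall x, g (i x) = f x) ->
  Ext_orthogonal C.
Proof.
move=> ip A_orth B_orth i_ext; apply: Ext_orthogonal_step.
  exact: Ext1_zero_coker ip (Ext_orthogonal_Ext1 B_orth) i_ext.
move=> K P k c kc P_proj.
have [W [v [b Wcp]]] := pullback_exists c p.
have [kw [kwb _]] := pullback_short_exact Wcp kc.
have [iw [iwv _]] := pullback_short_exact (pullbackC Wcp) ip.
apply: Ext_orthogonal_ker kwb _ B_orth.
exact: Ext_orthogonal_extension iwv A_orth (projective_Ext_orthogonal P_proj).
Qed.

End Ext.

(** * Gorenstein projective modules *)

Section FinitelyGenerated.
Variable S : comNzRingType.
Implicit Types A B C K L M N P Q U V W X Y Z : lmodType S.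

Definition row_comb M k (v : 'I_k -> M) (r : 'rV[S]_k) : M := \sum_j r 0 j *: v j.

Lemma row_comb_linear M k (v : 'I_k -> M) : linear (row_comb v).
Proof.
move=> a r s; rewrite /row_comb scaler_sumr -big_split; apply: eq_bigr => j _.
by rewrite !mxE scalerDl scalerA.
Qed.

Lemma finitely_generatedP M :
  finitely_generated M <-> exists k (f : {linear 'rV[S]_k -> M}), surjective f.
Proof.
split=> [[k [v vP]]|[k [f f_surj]]].
  exists k, (lin (row_comb_linear v)) => x; have [c ->] := vP x.
  by exists (\row_j c j); apply: eq_bigr => j _; rewrite mxE.
exists k, (fun j => f (delta_mx 0 j)) => x; have [r <-] := f_surj x.
exists (fun j => r 0 j); rewrite {1}[r]row_sum_delta linear_sum.
by apply: eq_bigr => j _; rewrite linearZ.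
Qed.

Lemma finitely_generated_surj A B (p : {linear A -> B}) :
  surjective p -> finitely_generated A -> finitely_generated B.
Proof.
move=> p_surj [k [v vP]]; exists k, (p \o v) => y.
have [x <-] := p_surj y; have [c ->] := vP x; exists c.
by rewrite linear_sum; apply: eq_bigr => j _; rewrite linearZ.
Qed.

(* A dual basis in the sense of the dual basis lemma: the phi_j are coordinate
   functionals, but the v_j need not be independent. *)
Definition has_dual_basis P : Prop :=
  exists k (v : 'I_k -> P) (phi : 'I_k -> {linear P -> S^o}),
  forall x, x = \sum_j phi j x *: v j.

Lemma row_coord_linear k (j : 'I_k) : linear (fun r : 'rV[S]_k => r 0 j : S^o).
Proof. by move=> a r s; rewrite !mxE. Qed.

Lemma row_dual_basis k : has_dual_basis 'rV[S]_k.
Proof.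
exists k, (delta_mx 0), (fun j => lin (row_coord_linear j)) => r /=.
exact: row_sum_delta.
Qed.

Lemma dual_basis_fg_projective P : has_dual_basis P -> fg_projective P.
Proof.
move=> [k [v [phi phiP]]]; split.
  by exists k, v => x; exists (fun j => phi j x).
move=> M N g f g_surj; have [m mP] := choice (fun j => g_surj (f (v j))).
have h_lin : linear (fun x => \sum_j phi j x *: m j).
  move=> a x y; rewrite scaler_sumr -big_split; apply: eq_bigr => j _.
  by rewrite linearP scalerDl scalerA.
exists (lin h_lin) => x; rewrite [in RHS](phiP x) !linear_sum.
by apply: eq_bigr => j _; rewrite !linearZ mP.
Qed.

Lemma fg_projective_dual_basis P : fg_projective P -> has_dual_basis P.
Proof.
move=> [/finitely_generatedP[k [f f_surj]] P_proj].
have [s sP] := P_proj _ _ f idfun f_surj.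
exists k, (fun j => f (delta_mx 0 j)), (fun j => lin (row_coord_linear j) \o s) => x.
rewrite -[LHS]sP {1}[s x]row_sum_delta linear_sum.
by apply: eq_bigr => j _; rewrite linearZ.
Qed.

Lemma row_fg_projective k : fg_projective 'rV[S]_k.
Proof. exact/dual_basis_fg_projective/row_dual_basis. Qed.

Lemma finitely_generated_extension A B C (f : {linear A -> B}) (p : {linear B -> C}) :
  exact_at f p -> surjective p -> finitely_generated A -> finitely_generated C ->
  finitely_generated B.
Proof.
move=> fp p_surj /finitely_generatedP[k [a a_surj]] /finitely_generatedP[l [c c_surj]].
have [_ Q_proj] := row_fg_projective l.
have [b bP] := Q_proj _ _ p c p_surj.
apply/finitely_generatedP; exists (k + l)%N.
have h_lin : linear (fun r : 'rV[S]_(k + l) => f (a (lsubmx r)) + b (rsubmx r)).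
  by move=> t r s; rewrite !linearP scalerDr addrACA.
exists (lin h_lin) => y; have [s sP] := c_surj (p y).
have /fp[x xP] : p (y - b s) = 0 by rewrite linearB bP sP subrr.
have [r rP] := a_surj x.
by exists (row_mx r s); rewrite /= row_mxKl row_mxKr rP xP subrK.
Qed.

Definition noetherian_module M : Prop :=
  forall K (i : {linear K -> M}), injective i -> finitely_generated K.

Lemma regular_noetherian_module : noetherian S -> noetherian_module S^o.
Proof.
move=> S_noeth K i i_inj.
have im_closed : submod_closed (image_pred i).
  split=> [|a _ _ /asboolP[x <-] /asboolP[y <-]]; apply/asboolP.
    by exists 0; rewrite linear0.
  by exists (a *: x + y); rewrite linearP.
have [k [v vP]] := S_noeth _ im_closed.
have v_im j : exists x, i x = v j.
  apply/asboolP/vP; exists (fun l => (l == j)%:R).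
  rewrite (bigD1 j) //= eqxx mul1r big1 ?addr0 // => l /negbTE->.
  by rewrite mul0r.
have [w wP] := choice v_im; exists k, w => x.
have /vP[c cP] : i x \in image_pred i by apply/asboolP; exists x.
exists c; apply: i_inj; rewrite cP linear_sum.
by apply: eq_bigr => j _; rewrite linearZ wP.
Qed.

(** A submodule K of B is split by K' = K intersected with ker p: K / K' embeds into C, and K' is
    covered by its pullback to A. Exactness at B is the form suited to the map S -> M given by a
    generator, which may have a kernel. *)
Lemma noetherian_module_extension A B C (f : {linear A -> B}) (p : {linear B -> C}) :
  exact_at f p -> noetherian_module A -> noetherian_module C -> noetherian_module B.
Proof.
move=> fp A_noeth C_noeth K i i_inj.
have [K' [k [k_inj kP]]] := ker_exists (p \o i).
have [D [d [d_surj dP]]] := coker_exists k.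
apply: (finitely_generated_extension dP d_surj).
  have [W [w [a [wa wa0 W_ex]]]] := pullback_exists (i \o k) f.
  apply: (@finitely_generated_surj _ _ w).
    move=> x; have /fp[y fy] : p (i (k x)) = 0 by apply/kP; exists x.
    by have [z [zx _]] := W_ex x y (esym fy); exists z.
  apply: (A_noeth _ a); apply: raddf_inj => z az; apply: wa0 => //.
  have ik_inj : injective (i \o k) by exact: inj_comp.
  by apply: ik_inj; rewrite wa az !linear0.
have [x /dP[y <-]|e eP] := factor_surj (f := p \o i) d_surj.
  by apply/kP; exists y.
apply: (C_noeth _ e); apply: raddf_inj => y; have [x <-] := d_surj y.
move=> edx; have /kP[z <-] : (p \o i) x = 0 by rewrite -[LHS]eP; apply: edx.
by apply/dP; exists z.
Qed.

Lemma fg_noetherian_module M :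
  noetherian S -> finitely_generated M -> noetherian_module M.
Proof.
move=> S_noeth [k [v vP]]; elim: k M v vP => [|k IHk] M v vP.
  move=> K i i_inj; exists 0%N, (fun=> 0) => x; exists (fun=> 0).
  have M0 y : y = 0 :> M by have [c ->] := vP y; rewrite big_ord0.
  by rewrite big_ord0; apply: i_inj; rewrite linear0.
have f_lin : linear (fun a : S^o => a *: v ord0).
  by move=> a b c; rewrite scalerDl scalerA.
have [C [p [p_surj fp]]] := coker_exists (lin f_lin).
apply: (noetherian_module_extension fp); first exact: regular_noetherian_module.
apply: (IHk C (fun j => p (v (fintype.lift ord0 j)))) => y.
have [x <-] := p_surj y; have [c ->] := vP x.
exists (fun j => c (fintype.lift ord0 j)); rewrite big_ord_recl linearD.
have -> : p (c ord0 *: v ord0) = 0 by apply/fp; exists (c ord0).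
by rewrite add0r linear_sum; apply: eq_bigr => j _; rewrite linearZ.
Qed.

End FinitelyGenerated.

(** * Duality and closure properties of Gorenstein projectives *)

Section Gorenstein.
Variable S : comNzRingType.
Implicit Types A B C K L M N P Q U V W X Y Z : lmodType S.

Lemma dual_map_linear A B (f : {linear A -> B}) :
  linear (fun phi : dual_module B => (phi \o f : {linear A -> S^o}) : dual_module A).
Proof. by move=> a phi psi; apply: linear_ext. Qed.

Definition dual_map A B (f : {linear A -> B}) : {linear dual_module B -> dual_module A} :=
  lin (dual_map_linear f).

Lemma dual_short_exact A B C (i : {linear A -> B}) (p : {linear B -> C}) :
  short_exact i p ->
  (forall f : {linear A -> S^o}, exists g : {linear B -> S^o}, forall x, g (i x) = f x) ->
  short_exact (dual_map p) (dual_map i).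
Proof.
move=> ip i_ext; have [i_inj ip_ex p_surj] := ip; split.
- move=> f g fg; apply: linear_ext => y; have [x <-] := p_surj y.
  exact: (congr1 (fun h : {linear B -> S^o} => h x) fg).
- move=> f; split=> [fi|[g <-]]; last first.
    by apply: linear_ext => x; rewrite /= (short_exact0 ip) linear0.
  have [_ /ip_ex[x <-]|g gP] := factor_surj (f := f) p_surj.
    exact: (congr1 (fun h : {linear A -> S^o} => h x) fi).
  by exists g; apply: linear_ext.
- by move=> f; have [g gP] := i_ext f; exists g; apply: linear_ext.
Qed.

(** Biduality is split into two halves that are chased separately: functionals separate points, and
    every functional on the dual is an evaluation. *)
Lemma gorenstein_projectiveP M :
  gorenstein_projective M <->
  [/\ finitely_generated M, Ext_orthogonal S^o M, Ext_orthogonal S^o (dual_module M),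
      forall x, (forall phi : {linear M -> S^o}, phi x = 0) -> x = 0
    & forall xi : {linear dual_module M -> S^o}, exists x,
        forall phi : {linear M -> S^o}, xi phi = phi x].
Proof.
split=> [[M_fg M_orth Md_orth [g bK gK]]|[M_fg M_orth Md_orth M_inj M_surj]].
  split=> // [x x0|xi].
    rewrite -[x]bK -[RHS]bK; congr (g _); apply: linear_ext => phi.
    by rewrite /= /evaluation x0 linear0.
  by exists (g xi) => phi; rewrite -{1}[xi]gK.
split=> //; have [g gP] := choice M_surj.
have gK : cancel g (@biduality S M).
  by move=> xi; apply: linear_ext => phi; apply/esym/gP.
exists g => // x; apply/subr0_eq/M_inj => phi.
by rewrite linearB -[phi (g _)]gP subrr.
Qed.

Lemma dual_basis_coord P k (v : 'I_k -> P) (phi : 'I_k -> {linear P -> S^o}) :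
  (forall x, x = \sum_j phi j x *: v j) ->
  forall f : dual_module P, f = \sum_j f (v j) *: (phi j : dual_module P).
Proof.
move=> phiP f; apply: linear_ext => x; rewrite {1}(phiP x) linear_sum.
(* Evaluation at x is linear in the functional; written as [biduality x], it passes through the
   sum. *)
rewrite -[RHS]/(biduality x _) linear_sum.
by apply: eq_bigr => j _; rewrite !linearZ; apply: mulrC.
Qed.

Lemma dual_basis_dual P : has_dual_basis P -> has_dual_basis (dual_module P).
Proof.
move=> [k [v [phi phiP]]]; exists k, phi, (fun j => biduality (v j)) => f.
exact: dual_basis_coord.
Qed.

Lemma fg_projective_gorenstein P : fg_projective P -> gorenstein_projective P.
Proof.
move=> P_proj; have P_db := fg_projective_dual_basis P_proj.
have [_ Pd_proj] := dual_basis_fg_projective (dual_basis_dual P_db).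
apply/gorenstein_projectiveP; have [P_fg P_proj'] := P_proj.
have [k [v [phi phiP]]] := P_db.
split=> [//||||xi]; try exact: projective_Ext_orthogonal.
  by move=> x x0; rewrite (phiP x) big1 // => j _; rewrite x0 scale0r.
exists (\sum_j xi (phi j) *: v j) => f.
rewrite [in LHS](dual_basis_coord phiP f) !linear_sum.
by apply: eq_bigr => j _; rewrite !linearZ; apply: mulrC.
Qed.

(** Ext^1(C,S) = 0 keeps the dual sequence exact, which settles the dual of B; biduality for B is
    then a five lemma chase. *)
Lemma gorenstein_extension A B C (i : {linear A -> B}) (p : {linear B -> C}) :
  short_exact i p ->
  gorenstein_projective A -> gorenstein_projective C -> gorenstein_projective B.
Proof.
move=> ip /gorenstein_projectiveP[A_fg A_orth Ad_orth A_inj A_surj].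
move=> /gorenstein_projectiveP[C_fg C_orth Cd_orth C_inj C_surj].
have [i_inj ip_ex p_surj] := ip.
have i_ext := Ext_orthogonal_Ext1 C_orth ip.
have pi_dual := dual_short_exact ip i_ext.
apply/gorenstein_projectiveP; split.
- exact: finitely_generated_extension ip_ex p_surj A_fg C_fg.
- exact: Ext_orthogonal_extension ip A_orth C_orth.
- exact: Ext_orthogonal_extension pi_dual Cd_orth Ad_orth.
- move=> y y0; have /ip_ex[x xy] : p y = 0 by apply: C_inj => phi; apply: (y0 (phi \o p)).
  suff x0 : x = 0 by rewrite -xy x0 linear0.
  by apply: A_inj => psi; have [phi <-] := i_ext psi; rewrite xy.
- move=> xi; have [z zP] := C_surj (xi \o dual_map p).
  have [y yz] := p_surj z; have [_ pi_ex di_surj] := pi_dual.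
  (* [xi] and evaluation at y agree on functionals that factor through C, so their difference is a
     functional on the dual of A, that is, evaluation at some x. *)
  have [_ /pi_ex[phi <-]|eta etaP] := factor_surj (f := xi \- biduality y) di_surj.
    by rewrite -[LHS]/((xi \o dual_map p) phi - phi (p y)) zP yz subrr.
  have [x xP] := A_surj eta; exists (y + i x) => phi.
  rewrite linearD -[phi (i x)]/(dual_map i phi x) -xP etaP.
  by rewrite -[LHS](subrK (phi y)) addrC.
Qed.

(** The dual of A is the cokernel of the map from the dual of C to that of B. A functional on the
    dual of C is evaluation at some p y, so evaluation at y extends it, as [Ext_orthogonal_coker]
    requires. *)
Lemma gorenstein_ker A B C (i : {linear A -> B}) (p : {linear B -> C}) :
  noetherian S -> short_exact i p ->
  gorenstein_projective B -> gorenstein_projective C -> gorenstein_projective A.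
Proof.
move=> S_noeth ip /gorenstein_projectiveP[B_fg B_orth Bd_orth B_inj B_surj].
move=> /gorenstein_projectiveP[C_fg C_orth Cd_orth C_inj C_surj].
have [i_inj ip_ex p_surj] := ip.
have i_ext := Ext_orthogonal_Ext1 C_orth ip.
have pi_dual := dual_short_exact ip i_ext.
apply/gorenstein_projectiveP; split.
- exact: (fg_noetherian_module S_noeth B_fg i_inj).
- exact: Ext_orthogonal_ker ip B_orth C_orth.
- apply: Ext_orthogonal_coker pi_dual Cd_orth Bd_orth _ => f.
  have [z zP] := C_surj f; have [y yz] := p_surj z.
  by exists (biduality y) => phi; rewrite zP -yz.
- move=> x x0; apply: i_inj; rewrite linear0; apply: B_inj => phi.
  exact: (x0 (phi \o i)).
- move=> xi; have [y yP] := B_surj (xi \o dual_map i).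
  have /ip_ex[x xy] : p y = 0.
    apply: C_inj => phi; rewrite -[LHS]/(dual_map p phi y) -yP.
    rewrite -[LHS]/(xi (dual_map i (dual_map p phi))) (short_exact0 pi_dual).
    exact: linear0.
  exists x => psi; have [phi phiP] := i_ext psi.
  have <- : dual_map i phi = psi by apply: linear_ext.
  by rewrite -[LHS]/((xi \o dual_map i) phi) yP /= xy.
Qed.

(** Extending functionals amounts here to Ext^1(C,S) = 0. It makes the dual sequence exact, and the
    dual of C becomes the kernel of an epimorphism. *)
Lemma gorenstein_coker A B C (i : {linear A -> B}) (p : {linear B -> C}) :
  short_exact i p -> gorenstein_projective A -> gorenstein_projective B ->
  (forall f : {linear A -> S^o}, exists g : {linear B -> S^o}, forall x, g (i x) = f x) ->
  gorenstein_projective C.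
Proof.
move=> ip /gorenstein_projectiveP[A_fg A_orth Ad_orth A_inj A_surj].
move=> /gorenstein_projectiveP[B_fg B_orth Bd_orth B_inj B_surj] i_ext.
have [i_inj ip_ex p_surj] := ip.
have pi_dual := dual_short_exact ip i_ext; have [_ pi_ex di_surj] := pi_dual.
apply/gorenstein_projectiveP; split.
- exact: finitely_generated_surj p_surj B_fg.
- exact: Ext_orthogonal_coker ip A_orth B_orth i_ext.
- exact: Ext_orthogonal_ker pi_dual Bd_orth Ad_orth.
- move=> z z0; have [y yz] := p_surj z.
  have [_ /pi_ex[phi <-]|eta etaP] := factor_surj (f := biduality y) di_surj.
    by rewrite -[LHS]/(phi (p y)) yz z0.
  have [x xP] := A_surj eta; rewrite -yz; apply/ip_ex; exists x.
  apply/esym/subr0_eq/B_inj => phi; rewrite linearB.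
  by rewrite -[phi y]/(biduality y phi) -etaP xP subrr.
- move=> xi; have [g gP] := Ext_orthogonal_Ext1 Ad_orth pi_dual xi.
  have [y yP] := B_surj g; exists (p y) => phi.
  by rewrite -gP yP.
Qed.

(** The dual of M embeds into the dual of S^m, hence is finitely generated. Its generators serve as
    the coordinates of M -> S^k, so a functional on M, being a combination of them, extends to
    S^k. *)
Lemma gorenstein_embedding M :
  noetherian S -> gorenstein_projective M ->
  exists P N (i : {linear M -> P}) (p : {linear P -> N}),
    [/\ short_exact i p, fg_projective P & gorenstein_projective N].
Proof.
move=> S_noeth M_G.
have [M_fg _ _ M_inj _] := (gorenstein_projectiveP M).1 M_G.
have [m [f f_surj]] := (finitely_generatedP M).1 M_fg.
have df_inj : injective (dual_map f).
  move=> phi psi eq_f; apply: linear_ext => y; have [x <-] := f_surj y.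
  exact: (congr1 (fun h : {linear 'rV[S]_m -> S^o} => h x) eq_f).
have [rowd_fg _] := dual_basis_fg_projective (dual_basis_dual (row_dual_basis S m)).
have [k [v vP]] := fg_noetherian_module S_noeth rowd_fg df_inj.
have i_lin : linear (fun x : M => \row_j (v j x : S)).
  by move=> a x y; apply/rowP => j; rewrite !mxE linearP.
have vE (c : 'I_k -> S) x :
    (\sum_j c j *: v j : dual_module M) x = \sum_j c j *: (v j x : S^o).
  rewrite -[LHS]/(biduality x _) linear_sum.
  by apply: eq_bigr => j _; rewrite linearZ.
have i_inj : injective (lin i_lin).
  apply: raddf_inj => x ix0; apply: M_inj => phi; have [c ->] := vP phi.
  rewrite vE big1 // => j _; have /rowP/(_ j) := ix0; rewrite !mxE => ->.
  exact: scaler0.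
have [N [p ip]] := coker_short_exact i_inj.
exists 'rV[S]_k, N, (lin i_lin), p; have P_proj := row_fg_projective S k.
split=> //; apply: gorenstein_coker ip M_G (fg_projective_gorenstein P_proj) _ => phi.
have [c ->] := vP phi.
have g_lin : linear (fun r : 'rV[S]_k => \sum_j c j * r 0 j : S^o).
  move=> a r s; rewrite scaler_sumr -big_split; apply: eq_bigr => j _.
  by rewrite !mxE mulrDr; congr (_ + _); apply: mulrCA.
exists (lin g_lin) => x; rewrite vE; apply: eq_bigr => j _.
by rewrite mxE.
Qed.

(** The coordinates of a map into P are functionals and extend one by one; the dual basis
    reassembles them. *)
Lemma gorenstein_Ext1_projective M P :
  gorenstein_projective M -> fg_projective P -> Ext1_zero P M.
Proof.
move=> /gorenstein_projectiveP[_ /Ext_orthogonal_Ext1 M1 _ _ _].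
move=> /fg_projective_dual_basis[k [v [phi phiP]]] A B i p ip f.
have [g gP] := choice (fun j => M1 _ _ _ _ ip (phi j \o f)).
have h_lin : linear (fun x => \sum_j (g j x : S) *: v j).
  move=> a x y; rewrite scaler_sumr -big_split; apply: eq_bigr => j _.
  by rewrite linearP scalerDl scalerA.
exists (lin h_lin) => x; rewrite [RHS]phiP; apply: eq_bigr => j _.
by rewrite gP.
Qed.

Lemma gorenstein_torsion_free M (w : S) :
  GRing.lreg w -> gorenstein_projective M -> forall x : M, w *: x = 0 -> x = 0.
Proof.
move=> w_reg /gorenstein_projectiveP[_ _ _ M_inj _] x wx0; apply: M_inj => phi.
by apply: w_reg; rewrite mulr0 -[LHS](linearZ_LR phi) wx0 linear0.
Qed.

Lemma pair_short_exact A B :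
  short_exact (pairing idfun \0 : {linear A -> (A * B)%type})
    (snd : {linear (A * B)%type -> B}).
Proof.
split=> [x y [->]//|[x y]|y]; last by exists (0, y).
by split=> [/= ->|[z [_ <-]]//]; exists x.
Qed.

Lemma gorenstein_pair A B :
  gorenstein_projective A -> gorenstein_projective B ->
  gorenstein_projective (A * B)%type.
Proof. exact: gorenstein_extension (pair_short_exact A B). Qed.

Lemma gorenstein0 : gorenstein_projective 'rV[S]_0.
Proof. exact/fg_projective_gorenstein/row_fg_projective. Qed.

End Gorenstein.

(** * Exact categories *)

Section ExactCategories.
Variables (C : preadditive) (E : forall X Y Z : C, mor X Y -> mor Y Z -> Prop).

Local Notation "g \oc f" := (mcomp g f) (at level 40, left associativity).

Lemma comp0m (X Y Z : C) (f : mor X Y) : (0 : mor Y Z) \oc f = 0.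
Proof. by apply: (addrI (0 \oc f)); rewrite -comp_addl !addr0. Qed.

Lemma compm0 (X Y Z : C) (g : mor Y Z) : g \oc (0 : mor X Y) = 0.
Proof. by apply: (addrI (g \oc 0)); rewrite -comp_addr !addr0. Qed.

Lemma compBm (X Y Z : C) (g h : mor Y Z) (f : mor X Y) :
  (g - h) \oc f = g \oc f - h \oc f.
Proof. by apply: (addIr (h \oc f)); rewrite -comp_addl !subrK. Qed.

Lemma compmB (X Y Z : C) (g : mor Y Z) (f h : mor X Y) :
  g \oc (f - h) = g \oc f - g \oc h.
Proof. by apply: (addIr (g \oc h)); rewrite -comp_addr !subrK. Qed.

Lemma kernel_mono (X Y Z W : C) (i : mor X Y) (p : mor Y Z) (f g : mor W X) :
  is_kernel i p -> i \oc f = i \oc g -> f = g.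
Proof.
move=> [pi0 ker_i] ifg; have [|h [_ h_uniq]] := ker_i W (i \oc f).
  by rewrite comp_assoc pi0 comp0m.
by rewrite -(h_uniq f) // -(h_uniq g).
Qed.

Lemma cokernel_epi (X Y Z W : C) (i : mor X Y) (p : mor Y Z) (f g : mor Z W) :
  is_cokernel i p -> f \oc p = g \oc p -> f = g.
Proof.
move=> [pi0 coker_p] fgp; have [|h [_ h_uniq]] := coker_p W (f \oc p).
  by rewrite -comp_assoc pi0 compm0.
by rewrite -(h_uniq f) // -(h_uniq g).
Qed.

Lemma split_kernel_summand (X Y Z : C) (i : mor X Y) (p : mor Y Z) (s : mor Z Y) :
  is_kernel i p -> p \oc s = idm Z -> direct_summand Z Y.
Proof.
move=> ker_i ps; have [pi0 ker_ex] := ker_i.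
have [|r [ir _]] := ker_ex Y (idm Y - s \oc p).
  by rewrite compmB comp_idr comp_assoc ps comp_idl subrr.
exists X, s, i, p, r; split=> //.
- apply: (kernel_mono ker_i).
  by rewrite comp_assoc ir compBm comp_idl -comp_assoc pi0 compm0 subr0 comp_idr.
- apply: (kernel_mono ker_i).
  by rewrite comp_assoc ir compBm comp_idl -comp_assoc ps comp_idr subrr compm0.
- by rewrite ir addrC subrK.
Qed.

Lemma split_cokernel_summand (X Y Z : C) (i : mor X Y) (p : mor Y Z) (r : mor Y X) :
  is_cokernel i p -> r \oc i = idm X -> direct_summand X Y.
Proof.
move=> coker_p ri; have [pi0 coker_ex] := coker_p.
have [|s [sp _]] := coker_ex Y (idm Y - i \oc r).
  by rewrite compBm comp_idl -comp_assoc ri comp_idr subrr.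
exists Z, i, s, r, p; split=> //.
- apply: (cokernel_epi coker_p).
  by rewrite -comp_assoc sp compmB comp_idr comp_assoc pi0 comp0m subr0 comp_idl.
- apply: (cokernel_epi coker_p).
  by rewrite -comp_assoc sp compmB comp_idr comp_assoc ri comp_idl subrr comp0m.
- by rewrite sp addrC subrK.
Qed.

Lemma projective_summand (X Y : C) :
  direct_summand X Y -> projective_object E Y -> projective_object E X.
Proof.
move=> [Z [i [_ [p [_ [pi _ _ _ _]]]]]] Y_proj V W q f q_defl.
have [g gP] := Y_proj V W q (f \oc p) q_defl.
by exists (g \oc i); rewrite comp_assoc gP -comp_assoc pi comp_idr.
Qed.

Lemma injective_summand (X Y : C) :
  direct_summand X Y -> injective_object E Y -> injective_object E X.
Proof.
move=> [Z [i [_ [p [_ [pi _ _ _ _]]]]]] Y_inj V W j f j_infl.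
have [g gP] := Y_inj V W j (i \oc f) j_infl.
by exists (p \oc g); rewrite -comp_assoc gP comp_assoc pi comp_idl.
Qed.

Lemma projective_biproduct (X Y Z : C) :
  is_biproduct X Y Z -> projective_object E X -> projective_object E Y ->
  projective_object E Z.
Proof.
move=> [i [j [p [q [_ _ _ _ ipjq]]]]] X_proj Y_proj V W d f d_defl.
have [g gP] := X_proj V W d (f \oc i) d_defl.
have [h hP] := Y_proj V W d (f \oc j) d_defl.
exists (g \oc p + h \oc q).
by rewrite comp_addr !comp_assoc gP hP -!comp_assoc -comp_addr ipjq comp_idr.
Qed.

Lemma injective_biproduct (X Y Z : C) :
  is_biproduct X Y Z -> injective_object E X -> injective_object E Y ->
  injective_object E Z.
Proof.
move=> [i [j [p [q [_ _ _ _ ipjq]]]]] X_inj Y_inj V W d f d_infl.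
have [g gP] := X_inj V W d (p \oc f) d_infl.
have [h hP] := Y_inj V W d (q \oc f) d_infl.
exists (i \oc g + j \oc h).
by rewrite comp_addl -!comp_assoc gP hP !comp_assoc -comp_addl ipjq comp_idl.
Qed.

Lemma zero_projective (Z : C) : is_zero_object Z -> projective_object E Z.
Proof.
by move=> Z0 V W d f _; exists 0; rewrite compm0 ((Z0 W).1 f).
Qed.

Lemma zero_injective (Z : C) : is_zero_object Z -> injective_object E Z.
Proof.
by move=> Z0 V W d f _; exists 0; rewrite comp0m ((Z0 V).2 f).
Qed.

Lemma biproduct_zero (X Z : C) : is_zero_object Z -> is_biproduct X Z X.
Proof.
move=> Z0; exists (idm X), 0, (idm X), 0; split.
- exact: comp_idl.
- by rewrite comp0m ((Z0 Z).1 (idm Z)).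
- exact: compm0.
- exact: comp0m.
- by rewrite comp_idl comp0m addr0.
Qed.

Lemma finite_direct_sum_ind (F G : C -> Prop) :
  (forall Z, is_zero_object Z -> G Z) -> (forall X, F X -> G X) ->
  (forall X Y Z, is_biproduct X Y Z -> G X -> G Y -> G Z) ->
  forall Y, finite_direct_sum F Y -> G Y.
Proof.
move=> G0 FG GD Y; elim=> [Z|X {}Y Z FX _ GY XYZ]; first exact: G0.
exact: GD XYZ (FG X FX) GY.
Qed.

(** * A criterion for an exact category to be Frobenius *)

Section FrobeniusCriterion.
Variable F : C -> Prop.
Hypothesis E_exact : exact_category E.
Hypothesis F_proj : forall X, F X -> projective_object E X.
Hypothesis F_inj : forall X, F X -> injective_object E X.
Hypothesis F_enough_proj : forall X, exists P (p : mor P X), F P /\ deflation E p.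
Hypothesis F_enough_inj : forall X, exists I (i : mor X I), F I /\ inflation E i.

Lemma projective_F_summand (X : C) :
  projective_object E X -> exists P, F P /\ direct_summand X P.
Proof.
move=> X_proj; have [P [p [FP p_defl]]] := F_enough_proj X.
have [s ps] := X_proj _ _ p (idm X) p_defl; have [K [i ip]] := p_defl.
exists P; split=> //; apply: (split_kernel_summand (i := i) _ ps).
by have [] := conflation_kernel E_exact ip.
Qed.

Lemma injective_F_summand (X : C) :
  injective_object E X -> exists I, F I /\ direct_summand X I.
Proof.
move=> X_inj; have [I [i [FI i_infl]]] := F_enough_inj X.
have [r ri] := X_inj _ _ i (idm X) i_infl; have [K [p ip]] := i_infl.
exists I; split=> //; apply: (split_cokernel_summand (p := p) _ ri).
by have [] := conflation_kernel E_exact ip.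
Qed.

(** A deflation from an object of F onto a projective object splits, so the latter is a summand of a
    single object of F and hence injective; dually for injective objects. The direct sum produced
    thus has one term. *)
Lemma frobenius_criterion :
  frobenius_category E /\
  forall X, (projective_object E X /\ injective_object E X) <->
    exists Y, finite_direct_sum F Y /\ direct_summand X Y.
Proof.
split; last first.
  move=> X; split=> [[X_proj _]|[Y [FY XY]]].
    have [P [FP XP]] := projective_F_summand X_proj; exists P; split=> //.
    have [[Z Z0] _] := exact_additive E_exact.
    exact: fds_add FP (fds_zero F Z0) (biproduct_zero P Z0).
  split; [apply: (projective_summand XY) | apply: (injective_summand XY)].
    apply: finite_direct_sum_ind FY; [exact: zero_projective | exact: F_proj |].
    exact: projective_biproduct.
  apply: finite_direct_sum_ind FY; [exact: zero_injective | exact: F_inj |].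
  exact: injective_biproduct.
split=> // [X|X|X].
- by have [P [p [/F_proj P_proj p_defl]]] := F_enough_proj X; exists P, p.
- by have [I [i [/F_inj I_inj i_infl]]] := F_enough_inj X; exists I, i.
- split=> [/projective_F_summand|/injective_F_summand] [P [FP XP]].
    exact: injective_summand XP (F_inj FP).
  exact: projective_summand XP (F_proj FP).
Qed.

End FrobeniusCriterion.
End ExactCategories.

(** * The category Mon *)

Lemma short_exact_iso (S : comNzRingType) (A B C A' B' C' : lmodType S)
    (i : {linear A -> B}) (p : {linear B -> C})
    (i' : {linear A' -> B'}) (p' : {linear B' -> C'})
    (a : {linear A -> A'}) (b : {linear B -> B'}) (c : {linear C -> C'})
    (a' : {linear A' -> A}) (b' : {linear B' -> B}) (c' : {linear C' -> C}) :
  cancel a a' -> cancel a' a -> cancel b b' -> cancel b' b ->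
  cancel c c' -> cancel c' c ->
  (forall x, b (i x) = i' (a x)) -> (forall y, c (p y) = p' (b y)) ->
  short_exact i p -> short_exact i' p'.
Proof.
move=> aK a'K bK b'K cK c'K bi cp [i_inj ip p_surj]; split.
- move=> x y ixy; apply: (can_inj a'K); apply: i_inj; apply: (can_inj bK).
  by rewrite !bi !a'K.
- move=> y; split=> [py|[x <-]].
    have /ip[x ix] : p (b' y) = 0 by apply: (can_inj cK); rewrite cp b'K py linear0.
    by exists (a x); rewrite -bi ix b'K.
  by rewrite -[x]a'K -bi -cp (short_exact0 (And3 i_inj ip p_surj)) linear0.
- move=> z; have [y py] := p_surj (c' z).
  by exists (b y); rewrite -cp py c'K.
Qed.

Lemma short_exact_idfun (S : comNzRingType) (A : lmodType S) :
  short_exact (idfun : {linear A -> A}) (\0 : {linear A -> 'rV[S]_0}).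
Proof.
split=> // [x|y]; last by exists 0; rewrite [y]thinmx0 linear0.
by split=> // _; exists x.
Qed.

Section Mon.
Variables (S : comNzRingType) (omega : S).
Hypothesis S_noetherian : noetherian S.
Hypothesis omega_regular : GRing.lreg omega.

Local Notation Mon := (Mon omega).
Local Notation conflation := (@Mon_conflation S omega).
Implicit Types (A B : arrow S) (P Q : lmodType S) (X Y Z W V K C : Mon).

Lemma in_MonP A :
  in_Mon omega A <->
  [/\ gorenstein_projective (src A), gorenstein_projective (tgt A), injective (arr A)
    & forall y, exists x, arr A x = omega *: y].
Proof. by split=> -[? ? ?] /coker_annP. Qed.

Lemma Mon_inj X : injective (arr (sval X)).
Proof. by have /in_MonP[] := svalP X. Qed.

Lemma Mon_ann X y : exists x, arr (sval X) x = omega *: y.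
Proof. by have /in_MonP[_ _ _] := svalP X; apply. Qed.

Lemma Mon_src X : gorenstein_projective (src (sval X)).
Proof. by have /in_MonP[] := svalP X. Qed.

Lemma Mon_tgt X : gorenstein_projective (tgt (sval X)).
Proof. by have /in_MonP[] := svalP X. Qed.

(** The cokernel condition puts omega G_0 inside f(G_1), so multiplication by omega factors through
    the injection f; the second identity follows by cancelling f. *)
Lemma Mon_inverse X :
  exists g : {linear tgt (sval X) -> src (sval X)},
    (forall y, arr (sval X) (g y) = omega *: y) /\
    (forall x, g (arr (sval X) x) = omega *: x).
Proof.
have [y|g gP] := factor_inj (f := omega \*: idfun) (@Mon_inj X).
  exact: Mon_ann.
by exists g; split=> // x; apply: Mon_inj; rewrite gP linearZ.
Qed.

Lemma arrow_mor_eq A B (f g : arrow_mor A B) :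
  (forall x, mor1 f x = mor1 g x) -> (forall x, mor0 f x = mor0 g x) -> f = g.
Proof. by move=> fg1 fg0; apply: arrow_mor_ext; apply: linear_ext. Qed.

Lemma mor1_eq A B (f g : arrow_mor A B) x : f = g -> mor1 f x = mor1 g x.
Proof. by move=> ->. Qed.

Lemma mor0_eq A B (f g : arrow_mor A B) x : f = g -> mor0 f x = mor0 g x.
Proof. by move=> ->. Qed.

(** * The zero object and biproducts of Mon *)

Definition zero_arrow : arrow S := Arrow (idfun : {linear 'rV[S]_0 -> 'rV[S]_0}).

Lemma zero_in_Mon : in_Mon omega zero_arrow.
Proof.
apply/in_MonP; split=> [||//|y]; try exact: gorenstein0.
by exists (omega *: y).
Qed.

Definition zero_Mon : Mon := exist _ zero_arrow zero_in_Mon.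

Lemma zero_Mon_zero : is_zero_object zero_Mon.
Proof.
move=> Y; split=> f; apply: arrow_mor_eq => x.
- by rewrite [x]thinmx0 !linear0.
- by rewrite [x]thinmx0 !linear0.
- by rewrite [LHS]thinmx0 [RHS]thinmx0.
- by rewrite [LHS]thinmx0 [RHS]thinmx0.
Qed.

Definition pair_arrow A B : arrow S :=
  Arrow (pairing (arr A \o fst) (arr B \o snd)
         : {linear (src A * src B)%type -> (tgt A * tgt B)%type}).

Lemma pair_in_Mon X Y : in_Mon omega (pair_arrow (sval X) (sval Y)).
Proof.
apply/in_MonP; split=> /=.
- by apply: gorenstein_pair; apply: Mon_src.
- by apply: gorenstein_pair; apply: Mon_tgt.
- by move=> [x y] [x' y'] [/Mon_inj-> /Mon_inj->].
- move=> [x y]; have [x' x'P] := Mon_ann x; have [y' y'P] := Mon_ann y.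
  by exists (x', y'); rewrite /= x'P y'P.
Qed.

Definition pair_Mon X Y : Mon := exist _ _ (pair_in_Mon X Y).

Section PairMorphisms.
Variables X Y Z : Mon.

Lemma pairing_mor_comm (f : mor Z X) (g : mor Z Y) x :
  arr (sval (pair_Mon X Y)) (pairing (mor1 f) (mor1 g) x) =
  pairing (mor0 f) (mor0 g) (arr (sval Z) x).
Proof. by rewrite /= !mor_comm. Qed.

Lemma copairing_mor_comm (f : mor X Z) (g : mor Y Z) x :
  arr (sval Z) (copairing (mor1 f) (mor1 g) x) =
  copairing (mor0 f) (mor0 g) (arr (sval (pair_Mon X Y)) x).
Proof. by rewrite /= linearD !mor_comm. Qed.

Definition pairing_mor f g : mor Z (pair_Mon X Y) :=
  @ArrowMor _ (sval Z) (sval (pair_Mon X Y)) _ _ (pairing_mor_comm f g).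
Definition copairing_mor f g : mor (pair_Mon X Y) Z :=
  @ArrowMor _ (sval (pair_Mon X Y)) (sval Z) _ _ (copairing_mor_comm f g).

End PairMorphisms.

Lemma pair_biproduct X Y : is_biproduct X Y (pair_Mon X Y).
Proof.
exists (pairing_mor (idm X) 0), (pairing_mor 0 (idm Y)).
exists (copairing_mor (idm X) 0), (copairing_mor 0 (idm Y)).
split; apply: arrow_mor_eq => x /=; rewrite ?addr0 ?add0r //.
- by case: x => x y; congr (_, _); rewrite /= ?addr0 ?add0r.
- by case: x => x y; congr (_, _); rewrite /= ?addr0 ?add0r.
Qed.

(** * The exact structure of Mon *)

Lemma conflation_is_kernel X Y Z (i : mor X Y) (p : mor Y Z) :
  conflation i p -> is_kernel i p.
Proof.
move=> [ip1 ip0]; have [i1_inj ip1_ex _] := ip1; have [i0_inj ip0_ex _] := ip0.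
split=> [|W f pf].
  by apply: arrow_mor_eq => x; [apply: (short_exact0 ip1) | apply: (short_exact0 ip0)].
have [x|g1 g1P] := factor_inj (f := mor1 f) i1_inj; first exact/ip1_ex/(mor1_eq x pf).
have [x|g0 g0P] := factor_inj (f := mor0 f) i0_inj; first exact/ip0_ex/(mor0_eq x pf).
have g_comm x : arr (sval X) (g1 x) = g0 (arr (sval W) x).
  by apply: i0_inj; rewrite -mor_comm g1P g0P mor_comm.
exists (ArrowMor g_comm); split=> [|h ih]; first exact: arrow_mor_eq.
apply: arrow_mor_eq => x; [apply: i1_inj | apply: i0_inj].
  by rewrite g1P -(mor1_eq x ih).
by rewrite g0P -(mor0_eq x ih).
Qed.

Lemma conflation_is_cokernel X Y Z (i : mor X Y) (p : mor Y Z) :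
  conflation i p -> is_cokernel i p.
Proof.
move=> [ip1 ip0]; have [_ ip1_ex p1_surj] := ip1; have [_ ip0_ex p0_surj] := ip0.
split=> [|W f fi].
  by apply: arrow_mor_eq => x; [apply: (short_exact0 ip1) | apply: (short_exact0 ip0)].
have [_ /ip1_ex[x <-]|g1 g1P] := factor_surj (f := mor1 f) p1_surj.
  exact: mor1_eq x fi.
have [_ /ip0_ex[x <-]|g0 g0P] := factor_surj (f := mor0 f) p0_surj.
  exact: mor0_eq x fi.
have g_comm x : arr (sval W) (g1 x) = g0 (arr (sval Z) x).
  by have [y <-] := p1_surj x; rewrite g1P mor_comm mor_comm g0P.
exists (ArrowMor g_comm); split=> [|h hp]; first exact: arrow_mor_eq.
apply: arrow_mor_eq => x.
  by have [y <-] := p1_surj x; rewrite /= g1P -(mor1_eq y hp).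
by have [y <-] := p0_surj x; rewrite /= g0P -(mor0_eq y hp).
Qed.

(* By closure of Gorenstein projectives under kernels of epimorphisms, every
   componentwise surjection has its kernel in Mon. *)
Lemma deflation_surj X Y (p : mor X Y) :
  deflation conflation p <-> surjective (mor1 p) /\ surjective (mor0 p).
Proof.
split=> [[K [i [[_ _ ?] [_ _ ?]]]]//|[p1_surj p0_surj]].
have [A1 [i1 ip1]] := ker_short_exact p1_surj.
have [A0 [i0 ip0]] := ker_short_exact p0_surj.
have [i1_inj ip1_ex _] := ip1; have [i0_inj ip0_ex _] := ip0.
have [x|a aP] := factor_inj (f := arr (sval X) \o i1) i0_inj.
  by apply/ip0_ex; rewrite /= -mor_comm (short_exact0 ip1) linear0.
have A_Mon : in_Mon omega (Arrow a).
  apply/in_MonP; split=> /=.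
  - exact: gorenstein_ker S_noetherian ip1 (Mon_src X) (Mon_src Y).
  - exact: gorenstein_ker S_noetherian ip0 (Mon_tgt X) (Mon_tgt Y).
  - move=> x y axy; apply: i1_inj; apply: Mon_inj.
    by have := congr1 i0 axy; rewrite !aP.
  (* The preimage x of omega y lies in the kernel of p in degree 1 because the structure map of Y is
     injective. *)
  - move=> y; have [x xP] := Mon_ann (i0 y).
    have /ip1_ex[x' x'P] : mor1 p x = 0.
      apply: Mon_inj; rewrite mor_comm xP linearZ (short_exact0 ip0) /=.
      by rewrite scaler0 linear0.
    by exists x'; apply: i0_inj; rewrite aP /= x'P xP linearZ.
by exists (exist _ _ A_Mon), (@ArrowMor _ (Arrow a) (sval X) i1 i0 (fun x => esym (aP x))).
Qed.

(** In both degrees W is an extension of K by Z, hence Gorenstein projective. The map q onto the old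
    cokernel is returned since it exhibits j as an inflation. *)
Lemma Mon_pushout X Y Z K (i : mor X Y) (p : mor Y K) (f : mor X Z) :
  conflation i p ->
  exists W (f' : mor Y W) (j : mor Z W) (q : mor W K),
    [/\ module_pushout (mor1 i) (mor1 f) (mor1 f') (mor1 j),
        module_pushout (mor0 i) (mor0 f) (mor0 f') (mor0 j) & conflation j q].
Proof.
move=> [ip1 ip0].
have [W1 [f1 [j1 Wp1]]] := pushout_exists (mor1 i) (mor1 f).
have [W0 [f0 [j0 Wp0]]] := pushout_exists (mor0 i) (mor0 f).
have [q1 [jq1 qf1]] := pushout_short_exact Wp1 ip1.
have [q0 [jq0 qf0]] := pushout_short_exact Wp0 ip0.
have [W1_comm W1_gen W1_eq] := Wp1; have [W0_comm W0_gen W0_eq] := Wp0.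
have W1_surj : surjective (copairing f1 j1).
  by move=> w; have [x [y ->]] := W1_gen w; exists (x, y).
pose h := copairing (f0 \o arr (sval Y)) (j0 \o arr (sval Z)).
have [[y z] /= yz0|a aP] := factor_surj (f := h) W1_surj.
  have [|x [ix fx]] := W1_eq y (- z).
    by rewrite linearN; apply/eqP; rewrite -addr_eq0 yz0.
  rewrite -ix -[z]opprK -fx !linearN !mor_comm W0_comm.
  exact: subrr.
have af y : a (f1 y) = f0 (arr (sval Y) y).
  by have := aP (y, 0); rewrite /= !linear0 !addr0.
have aj z : a (j1 z) = j0 (arr (sval Z) z).
  by have := aP (0, z); rewrite /= !linear0 !add0r.
have q_comm w : arr (sval K) (q1 w) = q0 (a w).
  have [y [z ->]] := W1_gen w; rewrite !linearD af aj qf1 qf0 mor_comm.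
  by rewrite (short_exact0 jq1) (short_exact0 jq0) linear0.
have W_Mon : in_Mon omega (Arrow a).
  apply/in_MonP; split=> /=.
  - exact: gorenstein_extension jq1 (Mon_src Z) (Mon_src K).
  - exact: gorenstein_extension jq0 (Mon_tgt Z) (Mon_tgt K).
  (* Four lemma: injectivity on K places w in the image of Z, where injectivity on Z finishes. *)
  - apply: raddf_inj => w aw; have [j1_inj jq1_ex _] := jq1.
    have /jq1_ex[z zw] : q1 w = 0.
      by apply: Mon_inj; rewrite q_comm aw !linear0.
    suff z0 : z = 0 by rewrite -zw z0 linear0.
    apply: Mon_inj; rewrite linear0; have [j0_inj _ _] := jq0; apply: j0_inj.
    by rewrite -aj zw aw linear0.
  - move=> w; have [y [z ->]] := W0_gen w.
    have [y' y'P] := Mon_ann y; have [z' z'P] := Mon_ann z.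
    by exists (f1 y' + j1 z'); rewrite linearD af aj y'P z'P !linearZ scalerDr.
pose W : Mon := exist _ _ W_Mon.
have f_comm y : arr (sval W) (f1 y) = f0 (arr (sval Y) y) by rewrite /= af.
have j_comm z : arr (sval W) (j1 z) = j0 (arr (sval Z) z) by rewrite /= aj.
exists W, (@ArrowMor _ (sval Y) (sval W) _ _ f_comm).
exists (@ArrowMor _ (sval Z) (sval W) _ _ j_comm).
by exists (@ArrowMor _ (sval W) (sval K) _ _ q_comm).
Qed.

Lemma Mon_is_pushout X Y Z W (i : mor X Y) (f : mor X Z) (f' : mor Y W) (j : mor Z W) :
  module_pushout (mor1 i) (mor1 f) (mor1 f') (mor1 j) ->
  module_pushout (mor0 i) (mor0 f) (mor0 f') (mor0 j) ->
  is_pushout i f j f'.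
Proof.
move=> [W1_comm W1_gen W1_eq] [W0_comm W0_gen W0_eq].
have W1_surj : surjective (copairing (mor1 f') (mor1 j)).
  by move=> w; have [x [y ->]] := W1_gen w; exists (x, y).
have W0_surj : surjective (copairing (mor0 f') (mor0 j)).
  by move=> w; have [x [y ->]] := W0_gen w; exists (x, y).
split=> [|V a b ab].
  by apply: arrow_mor_eq => x; rewrite /= ?W1_comm ?W0_comm.
have [[y z] /= yz0|c1 c1P] := factor_surj (f := copairing (mor1 a) (mor1 b)) W1_surj.
  have [|x [ix fx]] := W1_eq y (- z).
    by rewrite linearN; apply/eqP; rewrite -addr_eq0 yz0.
  rewrite -ix -[z]opprK -fx linearN; apply/eqP; rewrite subr_eq0.
  exact/eqP/(mor1_eq x ab).
have [[y z] /= yz0|c0 c0P] := factor_surj (f := copairing (mor0 a) (mor0 b)) W0_surj.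
  have [|x [ix fx]] := W0_eq y (- z).
    by rewrite linearN; apply/eqP; rewrite -addr_eq0 yz0.
  rewrite -ix -[z]opprK -fx linearN; apply/eqP; rewrite subr_eq0.
  exact/eqP/(mor0_eq x ab).
have c1f y : c1 (mor1 f' y) = mor1 a y.
  by have := c1P (y, 0); rewrite /= !linear0 !addr0.
have c1j z : c1 (mor1 j z) = mor1 b z.
  by have := c1P (0, z); rewrite /= !linear0 !add0r.
have c0f y : c0 (mor0 f' y) = mor0 a y.
  by have := c0P (y, 0); rewrite /= !linear0 !addr0.
have c0j z : c0 (mor0 j z) = mor0 b z.
  by have := c0P (0, z); rewrite /= !linear0 !add0r.
have c_comm w : arr (sval V) (c1 w) = c0 (arr (sval W) w).
  have [y [z ->]] := W1_gen w.
  by rewrite !linearD !mor_comm c1f c1j c0f c0j !mor_comm.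
exists (ArrowMor c_comm); split=> [|d [df dj]].
  by split; apply: arrow_mor_eq.
apply: arrow_mor_eq => w /=.
  have [y [z ->]] := W1_gen w; rewrite !linearD c1f c1j.
  by rewrite -(mor1_eq y df) -(mor1_eq z dj).
have [y [z ->]] := W0_gen w; rewrite !linearD c0f c0j.
by rewrite -(mor0_eq y df) -(mor0_eq z dj).
Qed.

Lemma Mon_pullback X Y Z K (i : mor K X) (p : mor X Y) (f : mor Z Y) :
  conflation i p ->
  exists W (f' : mor W X) (q : mor W Z) (j : mor K W),
    [/\ module_pullback (mor1 p) (mor1 f) (mor1 f') (mor1 q),
        module_pullback (mor0 p) (mor0 f) (mor0 f') (mor0 q) & conflation j q].
Proof.
move=> [ip1 ip0].
have [W1 [f1 [q1 Wp1]]] := pullback_exists (mor1 p) (mor1 f).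
have [W0 [f0 [q0 Wp0]]] := pullback_exists (mor0 p) (mor0 f).
have [j1 [jq1 fj1]] := pullback_short_exact Wp1 ip1.
have [j0 [jq0 fj0]] := pullback_short_exact Wp0 ip0.
have [W1_comm W1_0 W1_ex] := Wp1; have [W0_comm W0_0 W0_ex] := Wp0.
have W0_inj : injective (pairing f0 q0).
  by apply: raddf_inj => w [fw qw]; apply: W0_0.
pose h := pairing (arr (sval X) \o f1) (arr (sval Z) \o q1).
have [w|a aP] := factor_inj (f := h) W0_inj.
  have [|w' [fw' qw']] := W0_ex (arr (sval X) (f1 w)) (arr (sval Z) (q1 w)).
    by rewrite -!mor_comm W1_comm.
  by exists w'; rewrite /= fw' qw'.
have f_comm w : arr (sval X) (f1 w) = f0 (a w) by case: (aP w).
have q_comm w : arr (sval Z) (q1 w) = q0 (a w) by case: (aP w).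
have j_comm x : a (j1 x) = j0 (arr (sval K) x).
  apply: W0_inj => /=; congr (_, _).
    by rewrite -f_comm fj1 fj0 mor_comm.
  by rewrite -q_comm (short_exact0 jq1) (short_exact0 jq0) linear0.
have W_Mon : in_Mon omega (Arrow a).
  apply/in_MonP; split=> /=.
  - exact: gorenstein_extension jq1 (Mon_src K) (Mon_src Z).
  - exact: gorenstein_extension jq0 (Mon_tgt K) (Mon_tgt Z).
  - apply: raddf_inj => w aw; apply: W1_0; apply: Mon_inj.
      by rewrite f_comm aw !linear0.
    by rewrite q_comm aw !linear0.
  - move=> w; have [x xP] := Mon_ann (f0 w); have [z zP] := Mon_ann (q0 w).
    (* The two preimages agree in Y because its structure map is injective, so they come from W. *)
    have [|w' [fw' qw']] := W1_ex x z.
      by apply: Mon_inj; rewrite !mor_comm xP zP !linearZ W0_comm.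
    exists w'; apply: W0_inj => /=.
    by rewrite -f_comm -q_comm fw' qw' xP zP !linearZ.
pose W : Mon := exist _ _ W_Mon.
exists W, (@ArrowMor _ (sval W) (sval X) _ _ f_comm).
exists (@ArrowMor _ (sval W) (sval Z) _ _ q_comm).
by exists (@ArrowMor _ (sval K) (sval W) _ _ j_comm).
Qed.

Lemma Mon_is_pullback X Y Z W (p : mor X Y) (f : mor Z Y) (f' : mor W X) (q : mor W Z) :
  module_pullback (mor1 p) (mor1 f) (mor1 f') (mor1 q) ->
  module_pullback (mor0 p) (mor0 f) (mor0 f') (mor0 q) ->
  is_pullback p f q f'.
Proof.
move=> [W1_comm W1_0 W1_ex] [W0_comm W0_0 W0_ex].
have W1_inj : injective (pairing (mor1 f') (mor1 q)).
  by apply: raddf_inj => w [fw qw]; apply: W1_0.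
have W0_inj : injective (pairing (mor0 f') (mor0 q)).
  by apply: raddf_inj => w [fw qw]; apply: W0_0.
split=> [|V a b ab].
  by apply: arrow_mor_eq => x; rewrite /= ?W1_comm ?W0_comm.
have [x|c1 c1P] := factor_inj (f := pairing (mor1 a) (mor1 b)) W1_inj.
  have [|w [fw qw]] := W1_ex (mor1 a x) (mor1 b x); first exact: mor1_eq x ab.
  by exists w; rewrite /= fw qw.
have [x|c0 c0P] := factor_inj (f := pairing (mor0 a) (mor0 b)) W0_inj.
  have [|w [fw qw]] := W0_ex (mor0 a x) (mor0 b x); first exact: mor0_eq x ab.
  by exists w; rewrite /= fw qw.
have fc1 x : mor1 f' (c1 x) = mor1 a x by case: (c1P x).
have qc1 x : mor1 q (c1 x) = mor1 b x by case: (c1P x).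
have fc0 x : mor0 f' (c0 x) = mor0 a x by case: (c0P x).
have qc0 x : mor0 q (c0 x) = mor0 b x by case: (c0P x).
have c_comm x : arr (sval W) (c1 x) = c0 (arr (sval V) x).
  by apply: W0_inj => /=; rewrite -!mor_comm fc1 qc1 fc0 qc0 !mor_comm.
exists (ArrowMor c_comm); split=> [|d [fd qd]].
  by split; apply: arrow_mor_eq.
apply: arrow_mor_eq => x.
  by apply: W1_inj; rewrite /= fc1 qc1 -(mor1_eq x fd) -(mor1_eq x qd).
by apply: W0_inj; rewrite /= fc0 qc0 -(mor0_eq x fd) -(mor0_eq x qd).
Qed.

(** D / A is the pushout of D along B -> B / A. This yields the cokernel of a composite of
    inflations, for which injectivity alone would not give an object of Mon. *)
Lemma pushout_deflation_kernel (A B C D W : lmodType S) (i : {linear A -> B})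
    (p : {linear B -> C}) (j : {linear B -> D}) (j' : {linear C -> W}) (p' : {linear D -> W}) :
  module_pushout j p p' j' -> injective j -> short_exact i p -> short_exact (j \o i) p'.
Proof.
move=> [W_comm W_gen W_eq] j_inj ip; have [i_inj ip_ex p_surj] := ip; split.
- exact: inj_comp.
- move=> x; split=> [p'x|[a <-]]; last first.
    by rewrite /= W_comm (short_exact0 ip) linear0.
  have [|b [<- /ip_ex[a <-]]] := W_eq x 0; first by rewrite p'x linear0.
  by exists a.
- move=> w; have [x [c ->]] := W_gen w; have [b <-] := p_surj c.
  by exists (x + j b); rewrite linearD W_comm.
Qed.

Lemma Mon_exact : exact_category conflation.
Proof.
split.
- split; first by exists zero_Mon; apply: zero_Mon_zero.
  by move=> X Y; exists (pair_Mon X Y); apply: pair_biproduct.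
- by move=> X Y Z i p ip; split; [apply: conflation_is_kernel | apply: conflation_is_cokernel].
- move=> X Y Z X' Y' Z' i p i' p' a b c.
  move=> [a' [aK a'K]] [b' [bK b'K]] [c' [cK c'K]] bi cp [ip1 ip0].
  split.
  + apply: (short_exact_iso (a := mor1 a) (a' := mor1 a') (b := mor1 b) (b' := mor1 b')
      (c := mor1 c) (c' := mor1 c') _ _ _ _ _ _ _ _ ip1) => x.
    * exact: mor1_eq x aK.
    * exact: mor1_eq x a'K.
    * exact: mor1_eq x bK.
    * exact: mor1_eq x b'K.
    * exact: mor1_eq x cK.
    * exact: mor1_eq x c'K.
    * exact: mor1_eq x bi.
    * exact: mor1_eq x cp.
  + apply: (short_exact_iso (a := mor0 a) (a' := mor0 a') (b := mor0 b) (b' := mor0 b')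
      (c := mor0 c) (c' := mor0 c') _ _ _ _ _ _ _ _ ip0) => x.
    * exact: mor0_eq x aK.
    * exact: mor0_eq x a'K.
    * exact: mor0_eq x bK.
    * exact: mor0_eq x b'K.
    * exact: mor0_eq x cK.
    * exact: mor0_eq x c'K.
    * exact: mor0_eq x bi.
    * exact: mor0_eq x cp.
- by move=> X; exists zero_Mon, 0; split; apply: short_exact_idfun.
- by move=> X; apply/deflation_surj; split=> x; exists x.
- move=> X Y Z i j [C [p ip]] [D [q jq]].
  have [W [p' [j' [_ [W1 W0 _]]]]] := Mon_pushout p jq.
  have [[j1_inj _ _] [j0_inj _ _]] := jq; have [ip1 ip0] := ip.
  exists W, p'; split; [exact: pushout_deflation_kernel W1 j1_inj ip1|].
  exact: pushout_deflation_kernel W0 j0_inj ip0.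
- move=> X Y Z p q /deflation_surj[p1 p0] /deflation_surj[q1 q0].
  apply/deflation_surj; split=> z /=.
    by have [y <-] := q1 z; have [x <-] := p1 y; exists x.
  by have [y <-] := q0 z; have [x <-] := p0 y; exists x.
- move=> X Y Z i f [K [p ip]].
  have [W [f' [j [q [W1 W0 jq]]]]] := Mon_pushout f ip.
  by exists W, j, f'; split; [apply: Mon_is_pushout | exists K, q].
- move=> X Y Z p f [K [i ip]].
  have [W [f' [q [j [W1 W0 jq]]]]] := Mon_pullback f ip.
  by exists W, q, f'; split; [apply: Mon_is_pullback | exists K, j].
Qed.

(** * Basic objects: projectivity, injectivity, and enough of them *)

Lemma id_in_Mon P : fg_projective P -> in_Mon omega (id_arrow P).
Proof.
move=> /fg_projective_gorenstein P_G; apply/in_MonP; split=> // y.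
by exists (omega *: y).
Qed.

Lemma mul_in_Mon Q : fg_projective Q -> in_Mon omega (mul_arrow omega Q).
Proof.
move=> /fg_projective_gorenstein Q_G; apply/in_MonP; split=> // [|y]; last by exists y.
by apply: raddf_inj; apply: gorenstein_torsion_free omega_regular Q_G.
Qed.

Lemma id_arrow_projective P (P_Mon : in_Mon omega (id_arrow P)) :
  fg_projective P -> projective_object conflation (exist _ _ P_Mon).
Proof.
move=> [_ P_proj] Y Z p f /deflation_surj[p1_surj _].
have [g gP] := P_proj _ _ _ (mor1 f) p1_surj.
exists (@ArrowMor _ (id_arrow P) (sval Y) g (arr (sval Y) \o g) (fun=> erefl)).
apply: arrow_mor_eq => x /=; first exact: gP.
by rewrite -mor_comm gP; apply: (mor_comm f).
Qed.

Lemma mul_arrow_projective Q (Q_Mon : in_Mon omega (mul_arrow omega Q)) :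
  fg_projective Q -> projective_object conflation (exist _ _ Q_Mon).
Proof.
move=> [_ Q_proj] Y Z p f /deflation_surj[_ p0_surj].
have [g gP] := Q_proj _ _ _ (mor0 f) p0_surj.
have [h [hP _]] := Mon_inverse Y.
have g_comm x : arr (sval Y) ((h \o g) x) = g (arr (mul_arrow omega Q) x).
  by rewrite /= hP -linearZ.
exists (@ArrowMor _ (mul_arrow omega Q) (sval Y) (h \o g) g g_comm).
apply: arrow_mor_eq => x /=; last exact: gP.
apply: Mon_inj; rewrite !mor_comm hP linearZ /= gP.
by rewrite -linearZ.
Qed.

Lemma id_arrow_injective P (P_Mon : in_Mon omega (id_arrow P)) :
  fg_projective P -> injective_object conflation (exist _ _ P_Mon).
Proof.
move=> P_proj X Y i f [K [p [ip1 ip0]]].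
have [g gP] := gorenstein_Ext1_projective (Mon_tgt K) P_proj ip0 (mor0 f).
exists (@ArrowMor _ (sval Y) (id_arrow P) (g \o arr (sval Y)) g (fun=> erefl)).
apply: arrow_mor_eq => x /=; last exact: gP.
by rewrite mor_comm gP -mor_comm.
Qed.

Lemma mul_arrow_injective Q (Q_Mon : in_Mon omega (mul_arrow omega Q)) :
  fg_projective Q -> injective_object conflation (exist _ _ Q_Mon).
Proof.
move=> Q_proj X Y i f [K [p [ip1 ip0]]].
have [g gP] := gorenstein_Ext1_projective (Mon_src K) Q_proj ip1 (mor1 f).
have [h [arr_h h_arr]] := Mon_inverse Y; have [h' [arr_h' _]] := Mon_inverse X.
have g_comm x : arr (mul_arrow omega Q) (g x) = (g \o h) (arr (sval Y) x).
  by rewrite /= h_arr linearZ.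
exists (@ArrowMor _ (sval Y) (mul_arrow omega Q) g (g \o h) g_comm).
apply: arrow_mor_eq => x /=; first exact: gP.
(* The inverses up to omega commute with i, as is checked after applying the injective structure map
   of Y. *)
have -> : h (mor0 i x) = mor1 i (h' x).
  by apply: Mon_inj; rewrite arr_h mor_comm arr_h' linearZ.
(* The identity in degree 0 holds after multiplication by omega, which is injective on Q. *)
have [_ _ Q_inj _] := (in_MonP (mul_arrow omega Q)).1 Q_Mon.
by apply: Q_inj; rewrite gP mor_comm arr_h' linearZ.
Qed.

Lemma pair_basic P Q (P_Mon : in_Mon omega (id_arrow P))
    (Q_Mon : in_Mon omega (mul_arrow omega Q)) :
  fg_projective P -> fg_projective Q ->
  basic_object (pair_Mon (exist _ _ P_Mon) (exist _ _ Q_Mon)).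
Proof.
by move=> P_proj Q_proj; exists P, Q, P_Mon, Q_Mon; split=> //; apply: pair_biproduct.
Qed.

Lemma basic_projective Z : basic_object Z -> projective_object conflation Z.
Proof.
move=> [P [Q [P_Mon [Q_Mon [P_proj Q_proj PQ]]]]]; apply: projective_biproduct PQ _ _.
  exact: id_arrow_projective.
exact: mul_arrow_projective.
Qed.

Lemma basic_injective Z : basic_object Z -> injective_object conflation Z.
Proof.
move=> [P [Q [P_Mon [Q_Mon [P_proj Q_proj PQ]]]]]; apply: injective_biproduct PQ _ _.
  exact: id_arrow_injective.
exact: mul_arrow_injective.
Qed.

Lemma enough_basic_projectives X :
  exists Z (p : mor Z X), basic_object Z /\ deflation conflation p.
Proof.
have [X1_fg _ _ _] := Mon_src X; have [X0_fg _ _ _] := Mon_tgt X.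
have [k [a a_surj]] := (finitely_generatedP _).1 X1_fg.
have [m [b b_surj]] := (finitely_generatedP _).1 X0_fg.
have P_proj := row_fg_projective S k; have Q_proj := row_fg_projective S m.
have [h [arr_h _]] := Mon_inverse X.
have b_comm y : arr (sval X) ((h \o b) y) = b (arr (mul_arrow omega 'rV[S]_m) y).
  by rewrite /= arr_h -linearZ.
pose P : Mon := exist _ _ (id_in_Mon P_proj).
pose Q : Mon := exist _ _ (mul_in_Mon Q_proj).
pose p : mor P X := @ArrowMor _ (sval P) (sval X) a (arr (sval X) \o a) (fun=> erefl).
pose q : mor Q X := @ArrowMor _ (sval Q) (sval X) (h \o b) b b_comm.
exists (pair_Mon P Q), (copairing_mor p q); split; first exact: pair_basic.
apply/deflation_surj; split=> y /=.
  by have [x <-] := a_surj y; exists (x, 0); rewrite /= !linear0 addr0.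
by have [x <-] := b_surj y; exists (0, x); rewrite /= !linear0 add0r.
Qed.

(** The cokernel has to lie in Mon. In degree 1 it is an extension of M by P, obtained by pushing
    out along b; in degree 0 an extension of N by Q, along a. Each degree uses the component whose
    cokernel is Gorenstein projective; the composites [a \o arr (sval X)] and [b \o h] need not have
    such a cokernel. *)
Lemma enough_basic_injectives X :
  exists Z (i : mor X Z), basic_object Z /\ inflation conflation i.
Proof.
have [P [N [a [r [ar P_proj N_G]]]]] := gorenstein_embedding S_noetherian (Mon_tgt X).
have [Q [M [b [s [bs Q_proj M_G]]]]] := gorenstein_embedding S_noetherian (Mon_src X).
have [a_inj ar_ex _] := ar; have [b_inj bs_ex _] := bs.
have [h [arr_h h_arr]] := Mon_inverse X.
have h_inj : injective h.
  apply: raddf_inj => x hx; apply: (gorenstein_torsion_free omega_regular (Mon_tgt X)).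
  by rewrite -arr_h hx linear0.
have b_comm x : arr (mul_arrow omega Q) (b x) = (b \o h) (arr (sval X) x).
  by rewrite /= h_arr linearZ.
pose IP : Mon := exist _ _ (id_in_Mon P_proj).
pose IQ : Mon := exist _ _ (mul_in_Mon Q_proj).
pose ia : mor X IP := @ArrowMor _ (sval X) (sval IP) (a \o arr (sval X)) a (fun=> erefl).
pose ib : mor X IQ := @ArrowMor _ (sval X) (sval IQ) b (b \o h) b_comm.
pose I : Mon := pair_Mon IP IQ; pose i : mor X I := pairing_mor ia ib.
exists I, i; split; first exact: pair_basic.
have i1_inj : injective (pairing (a \o arr (sval X)) b) by move=> x y [_ /b_inj].
have i0_inj : injective (pairing a (b \o h)) by move=> x y [/a_inj].
have [C1 [p1 ip1]] := coker_short_exact i1_inj.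
have [C0 [p0 ip0]] := coker_short_exact i0_inj.
have [_ ip1_ex p1_surj] := ip1; have [_ ip0_ex p0_surj] := ip0.
have [q1 [jq1 _]] := pushout_short_exact (pushoutC (coker_pairing_pushout ip1)) bs.
have [q0 [jq0 _]] := pushout_short_exact (coker_pairing_pushout ip0) ar.
have [_ /ip1_ex[x <-]|c cP] := factor_surj (f := p0 \o arr (sval I)) p1_surj.
  by apply/ip0_ex; exists (arr (sval X) x); rewrite [RHS](mor_comm i x).
have C_Mon : in_Mon omega (Arrow c).
  apply/in_MonP; split=> /=.
  - exact: gorenstein_extension jq1 (fg_projective_gorenstein P_proj) M_G.
  - exact: gorenstein_extension jq0 (fg_projective_gorenstein Q_proj) N_G.
  (* If (x, omega y) is the image of x0, then omega kills s y, so y = b x1 as M is torsion-free.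
     Injectivity of b and h identifies x0 with the image of x1, and (x, y) comes from x1. *)
  - apply: raddf_inj => z cz; have [[x y] xyz] := p1_surj z.
    have /ip0_ex[x0 [ax0 bx0]] : (p0 \o arr (sval I)) (x, y) = 0 by rewrite -cP xyz.
    have /bs_ex[x1 bx1] : s y = 0.
      apply: (gorenstein_torsion_free omega_regular M_G).
      by rewrite -linearZ /= -[omega *: y]bx0 (short_exact0 bs).
    have x0E : x0 = arr (sval X) x1.
      apply: h_inj; apply: b_inj; rewrite h_arr linearZ /= bx1.
      exact: bx0.
    by rewrite -xyz; apply/ip1_ex; exists x1; rewrite /= -x0E ax0 bx1.
  - move=> z; have [y <-] := p0_surj z; have [x xP] := @Mon_ann I y.
    by exists (p1 x); rewrite cP -linearZ; apply: (congr1 p0 xP).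
exists (exist _ _ C_Mon).
by exists (@ArrowMor _ (sval I) (Arrow c) p1 p0 cP).
Qed.

End Mon.

Theorem theorem2p15 (S : comNzRingType) (n : {pred S}) (omega : S)
    (S_noetherian : noetherian S) (S_local : local_ring n)
    (omega_in_n : omega \in n) (omega_regular : GRing.lreg omega) :
  frobenius_category (@Mon_conflation S omega) /\
  forall X : Mon omega,
    (projective_object (@Mon_conflation S omega) X /\
     injective_object (@Mon_conflation S omega) X) <->
    exists Y : Mon omega,
      finite_direct_sum (@basic_object S omega) Y /\ direct_summand X Y.
Proof.
apply: frobenius_criterion.
- exact: Mon_exact.
- exact: basic_projective.
- exact: basic_injective.
- exact: enough_basic_projectives.
- exact: enough_basic_injectives.
Qed.
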